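(* Let the data $n,m,\mu,\rho,\lambda,\bm C,\bm b,\mathcal{A}$ satisfy the standing assumptions (i)–(iii) of the context, and let $g^*$ be the optimal value of the dual problem (D). Then Algorithm 1 (described in the context), run with tolerance $\varepsilon=0$ from any $\bm U^0\in\mathcal{F}$ and with any admissible parameters, either stops at some finite iteration $k$ having reached the optimal value, $g(\bm U^k)=g^*$, or generates an infinite sequence $\{\bm U^k\}$ such that $$\lim_{k\to\infty}|g(\bm U^k)-g^*|=0 .$$
   Context: Notation. $\mathbb{S}^n$ is the space of real symmetric $n\times n$ matrices with inner product $\bm A\bullet\bm X=\sum_{i,j}A_{ij}X_{ij}$ and Frobenius norm; $\bm X\succ\bm 0$ means positive definite; $\|\bm W\|_\infty=\max_{i,j}|W_{ij}|$. The space $\mathbb{R}^m\times\mathbb{S}^n\times\mathbb{S}^n$ carries the inner product $\langle(\bm y_1,\bm W_1,\bm S_1),(\bm y_2,\bm W_2,\bm S_2)\rangle=\bm y_1^\top\bm y_2+\bm W_1\bullet\bm W_2+\bm S_1\bullet\bm S_2$ and the induced norm; gradients are taken with respect to it. For a closed convex set $\Omega$, $P_\Omega$ is the orthogonal projection onto $\Omega$. $[x]_+=\max\{x,0\}$. Data. $\mu,\rho,\lambda>0$, $\bm C\in\mathbb{S}^n$, $\bm b\in\mathbb{R}^m$, and $\mathcal{A}:\mathbb{S}^n\to\mathbb{R}^m$, $\mathcal{A}(\bm X)=(\bm A_1\bullet\bm X,\dots,\bm A_m\bullet\bm X)^\top$ with $\bm A_i\in\mathbb{S}^n$; its adjoint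 is $\mathcal{A}^\top(\bm y)=\sum_i y_i\bm A_i$. The sets. Put $\bar n=n(n-1)/2$ and let $\mathcal{K}$ be a fixed bijection (enumeration) from $\{(i,j):1\le i<j\le n\}$ to $\{1,\dots,\bar n\}$. For $\bm Z\in\mathbb{S}^{\bar n}$ let $\mathcal{Q}^\top(\bm Z)\in\mathbb{S}^n$ be the symmetric matrix with zero diagonal and, for $i<j$ and $a=\mathcal{K}(i,j)$, $[\mathcal{Q}^\top(\bm Z)]_{ij}=\sum_{l>a}Z_{a,l}-\sum_{l<a}Z_{l,a}$. Let $\mathcal{W}=\{\bm W\in\mathbb{S}^n:\|\bm W\|_\infty\le\rho\}$, $\mathcal{S}=\{\mathcal{Q}^\top(\bm Z):\bm Z\in\mathbb{S}^{\bar n},\ \|\bm Z\|_\infty\le\lambda\}$, $\mathcal{M}=\mathbb{R}^m\times\mathcal{W}\times\mathcal{S}$. For $\bm U=(\bm y,\bm W,\bm S)$ let $\mathcal{B}(\bm U)=-\mathcal{A}^\top(\bm y)+\tfrac12\bm W+\bm S$, $\mathcal{N}=\{\bm U:\bm C+\mathcal{B}(\bm U)\succ\bm 0\}$, $\mathcal{F}=\mathcal{M}\cap\mathcal{N}$. Dual problem (D): maximize $g(\bm U)=\bm b^\top\bm y+\mu\log\det(\bm C+\mathcal{B}(\bm U))+n\mu-n\mu\log\mu$ over $\bm U=(\bm y,\bm W,\bm S)\in\mathcal{F}$. Standing assumptions: (i) $\mathcal{A}$ is surjective; (ii) there is $\widehat{\bm X}\succ\bm 0$ with $\mathcal{A}(\widehat{\bm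 X})=\bm b$; (iii) $\mathcal{F}\neq\emptyset$. Algorithm 1. Parameters: tolerance $\varepsilon\ge0$, $\tau,\gamma,\beta\in(0,1)$, $0<\alpha_{\min}<\alpha_{\max}<\infty$, integer $M>0$, $\bm U^0\in\mathcal{F}$, $\alpha_0\in[\alpha_{\min},\alpha_{\max}]$. Set $k=0$. Step 1: $\bm R^k=P_{\mathcal{M}}(\bm U^k+\nabla g(\bm U^k))-\bm U^k$; if $\|\bm R^k\|\le\varepsilon$, terminate. Step 2: $\bm D^k=P_{\mathcal{M}}(\bm U^k+\alpha_k\nabla g(\bm U^k))-\bm U^k$. Let $\bm L_k\bm L_k^\top=\bm C+\mathcal{B}(\bm U^k)$ be the Cholesky decomposition and $\theta$ the minimum eigenvalue of $\bm L_k^{-1}\mathcal{B}(\bm D^k)(\bm L_k^\top)^{-1}$. Set $\nu_k=1$ if $\theta\ge0$ and $\nu_k=\min\{1,-\tau/\theta\}$ otherwise. Let $\sigma_k$ be the largest element of $\{1,\beta,\beta^2,\dots\}$ with $g(\bm U^k+\sigma_k\nu_k\bm D^k)\ge\min_{[k-M+1]_+\le j\le k}g(\bm U^j)+\gamma\sigma_k\nu_k\langle\nabla g(\bm U^k),\bm D^k\rangle$. Step 3: $\bm U^{k+1}=\bm U^k+\sigma_k\nu_k\bm D^k$, $p_k=\langle\bm U^{k+1}-\bm U^k,\nabla g(\bm U^{k+1})-\nabla g(\bm U^k)\rangle$; $\alpha_{k+1}=\alpha_{\max}$ if $p_k\ge0$, and $\alpha_{k+1}=\min\{\alpha_{\max},\max\{\alpha_{\min},-\|\bm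 U^{k+1}-\bm U^k\|^2/p_k\}\}$ otherwise. Replace $k$ by $k+1$ and return to Step 1. *)

(* Defs.v *)
From HB Require Import structures.
From mathcomp Require Import all_boot all_order all_algebra.
From mathcomp Require Import all_classical all_reals all_analysis.

Set Implicit Arguments.
Unset Strict Implicit.
Unset Printing Implicit Defensive.
Import Order.TTheory GRing.Theory Num.Theory.
Import numFieldNormedType.Exports.

Local Open Scope classical_set_scope.
Local Open Scope ring_scope.

Definition frob_dot (R : realType) (p q : nat) (A B : 'M[R]_(p, q)) : R :=
  \sum_i \sum_j A i j * B i j.

Definition posdefmx (R : realType) (n : nat) (A : 'M[R]_n) : Prop :=
  A \is symmetricmx /\
  forall x : 'cV[R]_n, x != 0 -> 0 < (x^T *m A *m x) 0 0.

Definition is_cholesky (R : realType) (n : nat) (A L : 'M[R]_n) : Prop :=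
  [/\ is_trig_mx L, forall i, 0 < L i i & L *m L^T = A].

Definition is_min_eigenvalue (R : realType) (n : nat) (A : 'M[R]_n) (t : R) :
    Prop :=
  eigenvalue A t /\ forall s, eigenvalue A s -> t <= s.

(* Points of R^m x S^n x S^n are the triples satisfying [is_sym]: symmetry is
   a predicate on triples with arbitrary square matrices. *)
Notation triple R m n := ('cV[R]_m * 'M[R]_n * 'M[R]_n)%type.

Section Space.
Context {R : realType} {m n : nat}.
Implicit Types U V G : triple R m n.

Definition is_sym U : Prop :=
  U.1.2 \is symmetricmx /\ U.2 \is symmetricmx.

Definition dot U V : R :=
  frob_dot U.1.1 V.1.1 + frob_dot U.1.2 V.1.2 + frob_dot U.2 V.2.

(* The Euclidean norm; the library's norm `|U| on triples is the max norm
   (same topology, hence the same notion of differential). *)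
Definition enorm U : R := Num.sqrt (dot U U).

(* The gradient in R^m x S^n x S^n: only the restriction of the differential
   to symmetric directions counts, and the representative is symmetric. *)
Definition is_gradient (f : triple R m n -> R) U G : Prop :=
  [/\ differentiable f U, is_sym G &
      forall V, is_sym V -> 'd f U V = dot G V].

(* The default value 0 is used only where f has no gradient. *)
Definition gradient (f : triple R m n -> R) U : triple R m n :=
  xget 0 [set G | is_gradient f U G].

Definition is_projection (O : set (triple R m n)) U V : Prop :=
  O V /\ forall V', O V' -> enorm (U - V) <= enorm (U - V').

(* The default value 0 is used only where no nearest point exists. *)
Definition projection (O : set (triple R m n)) U : triple R m n :=
  xget 0 [set V | is_projection O U V].

End Space.

Definition nbar (n : nat) : nat := ((n * (n - 1)) %/ 2)%N.

Definition upper_pair (n : nat) : Type :=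
  {p : 'I_n * 'I_n | (p.1 < p.2)%N}.

Record problem (R : realType) (m n : nat) := Problem {
  mu : R;
  rho : R;
  lambda : R;
  Cmat : 'M[R]_n;
  bvec : 'cV[R]_m;
  Amat : 'I_m -> 'M[R]_n;
  pair_enum : upper_pair n -> 'I_(nbar n) }.

Section Problem.
Context {R : realType} {m n : nat} (P : problem R m n).
Implicit Types U : triple R m n.

Definition calA (X : 'M[R]_n) : 'cV[R]_m := \col_i frob_dot (Amat P i) X.

Definition calAT (y : 'cV[R]_m) : 'M[R]_n := \sum_i y i 0 *: Amat P i.

Definition QT_entry (Z : 'M[R]_(nbar n)) (a : 'I_(nbar n)) : R :=
  \sum_(l < nbar n | (a < l)%N) Z a l - \sum_(l < nbar n | (l < a)%N) Z l a.

(* [insub (i, j)] is [Some] of the pair (i, j) exactly when i < j. *)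
Definition QT (Z : 'M[R]_(nbar n)) : 'M[R]_n :=
  \matrix_(i, j)
    if (insub (i, j) : option (upper_pair n)) is Some p
    then QT_entry Z (pair_enum P p)
    else if (insub (j, i) : option (upper_pair n)) is Some p
    then QT_entry Z (pair_enum P p)
    else 0.

(* The library's norm `|W| of a matrix is the largest absolute value of its
   entries. *)
Definition Wset : set 'M[R]_n :=
  [set W | W \is symmetricmx /\ `|W| <= rho P].

Definition Sset : set 'M[R]_n :=
  QT @` [set Z | Z \is symmetricmx /\ `|Z| <= lambda P].

Definition Mset : set (triple R m n) :=
  [set U | Wset U.1.2 /\ Sset U.2].

Definition calB U : 'M[R]_n := - calAT U.1.1 + 2^-1 *: U.1.2 + U.2.

Definition Nset : set (triple R m n) :=
  [set U | is_sym U /\ posdefmx (Cmat P + calB U)].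

Definition Fset : set (triple R m n) := Mset `&` Nset.

Definition dual_obj U : R :=
  frob_dot (bvec P) U.1.1 + mu P * ln (\det (Cmat P + calB U))
  + n%:R * mu P - n%:R * mu P * ln (mu P).

Definition dual_value : \bar R :=
  ereal_sup [set (dual_obj U)%:E | U in Fset].

Definition A_surjective : Prop :=
  forall y : 'cV[R]_m, exists2 X : 'M[R]_n, X \is symmetricmx & calA X = y.

Definition primal_slater : Prop :=
  exists2 X : 'M[R]_n, posdefmx X & calA X = bvec P.

End Problem.

Record params (R : realType) := Params {
  eps : R;
  tau : R;
  gamma : R;
  beta : R;
  alpha_min : R;
  alpha_max : R;
  memory : nat }.

Definition admissible (R : realType) (a : params R) : Prop :=
  [/\ 0 <= eps a, 0 < tau a < 1, 0 < gamma a < 1 & 0 < beta a < 1] /\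
  [/\ 0 < alpha_min a, alpha_min a < alpha_max a & (0 < memory a)%N].

Section Algorithm.
Context {R : realType} {m n : nat} (P : problem R m n) (a : params R).
Implicit Types (U V D : triple R m n) (u : nat -> triple R m n).

Local Notation g := (dual_obj P).
Local Notation grad := (gradient g).

Definition proj_step (t : R) U : triple R m n :=
  projection (Mset P) (U + t *: grad U) - U.

Definition stops U : Prop := enorm (proj_step 1 U) <= eps a.

Definition is_nu U D (nu : R) : Prop :=
  exists L theta,
    [/\ is_cholesky (Cmat P + calB P U) L,
        is_min_eigenvalue (invmx L *m calB P D *m invmx (L^T)) theta &
        nu = if 0 <= theta then 1 else Num.min 1 (- tau a / theta)].

(* With truncated subtraction, k.+1 - M is [k - M + 1]_+; the initial value
   g (u k) of the iterated minimum is one of its terms, since M > 0. *)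
Definition reference_value u (k : nat) : R :=
  \big[Num.min/g (u k)]_(k.+1 - memory a <= j < k.+1) g (u j).

Definition accepted u (k : nat) D (nu s : R) : Prop :=
  reference_value u k + gamma a * s * nu * dot (grad (u k)) D
  <= g (u k + (s * nu) *: D).

Definition is_sigma u (k : nat) D (nu s : R) : Prop :=
  [/\ exists i : nat, s = beta a ^+ i,
      accepted u k D nu s &
      forall i : nat, accepted u k D nu (beta a ^+ i) -> beta a ^+ i <= s].

Definition next_alpha U V : R :=
  let p := dot (V - U) (grad V - grad U) in
  if 0 <= p then alpha_max a
  else Num.min (alpha_max a)
         (Num.max (alpha_min a) (- (enorm (V - U) ^+ 2) / p)).

Definition iteration u (alpha : nat -> R) (k : nat) : Prop :=
  let D := proj_step (alpha k) (u k) in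
  exists nu s,
    [/\ is_nu (u k) D nu, is_sigma u k D nu s,
        u k.+1 = u k + (s * nu) *: D &
        alpha k.+1 = next_alpha (u k) (u k.+1)].

(* An execution that stops at iteration k determines u and alpha only up to
   index k; their later values are unconstrained. *)
Definition execution (U0 : triple R m n) (alpha0 : R) u (alpha : nat -> R) :
    Prop :=
  [/\ u 0%N = U0, alpha 0%N = alpha0 &
      forall k : nat, (forall j : nat, (j <= k)%N -> ~ stops (u j)) ->
        iteration u alpha k].

End Algorithm.

(* Main.v *)
(* The dual objective g is concave, because
     ln det Y <= ln det Z + <Z^-1, Y - Z>
   for positive definite Y and Z (apply ln det A <= tr A - n to L^-1 Y L^-T,
   where Z = L L^T), and this inequality also identifies the gradient of g. A
   strictly feasible primal point bounds the slack matrix Z = C + B(U), its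
   inverse and U itself on every superlevel set of g. On the superlevel set of
   U^0, which the iterates never leave, the backtracking line search therefore
   takes steps sigma_k nu_k >= c > 0. Write d_k = <grad g(U^k), D^k>, so that
   |D^k|^2 <= alpha_k d_k, and e_k = g^* - g(U^k). The line search gives
     e_(k+1) <= max over the window of the e_j - gamma c d_k,
   while concavity and the variational inequality of the projection give
     e_(k+1) <= d_k + K sqrt d_k.
   If d_k is small then so is e_(k+1); if it is not, e_(k+1) lies below the
   window maximum by a fixed amount. Hence e_k tends to 0. *)
Require Import Defs.
From HB Require Import structures.
From mathcomp Require Import all_boot all_order all_algebra.
From mathcomp Require Import all_classical all_reals all_analysis.
From mathcomp Require Import ring lra.
Import Order.TTheory GRing.Theory Num.Theory.
Import numFieldNormedType.Exports.

Set Implicit Arguments.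
Unset Strict Implicit.
Unset Printing Implicit Defensive.

Local Open Scope classical_set_scope.
Local Open Scope ring_scope.

(** * Frobenius inner product and positive definite matrices *)

(** The trace of the inverse, [\tr (invmx Z)], stands in for the reciprocal of the least eigenvalue:
    [posdef_lower] turns it into a lower bound on the quadratic form of [Z], and the damping [nu]
    limits its growth along a step to the factor [n / (1 - tau)]. Cholesky factors thus replace
    spectral decompositions; the only eigenvalue is the one that defines [nu]. The line search needs
    a quadratic lower model of g. It is obtained without second derivatives: concavity is applied
    from the new point back to the old one, and the resolvent identity compares the two inverse
    slacks. The curvature of the model is at most a multiple of |D|^2, hence of d_k, so d_k cancels
    from the bound on rejected steps; this is why c does not depend on k. No maximizer is available
    to compare with. The gap estimate is therefore proved against every feasible V at or above the
    level of U^0 and only then passed to the supremum. *)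

Lemma cauchy_schwarz (R : realType) (V : lmodType R) (b : V -> V -> R) :
  (forall x y, b x y = b y x) ->
  (forall c x y z, b (c *: x + y) z = c * b x z + b y z) ->
  (forall x, 0 <= b x x) ->
  forall x y, b x y ^+ 2 <= b x x * b y y.
Proof.
move=> bC bL b_ge0 x y.
have bR c u v w : b w (c *: u + v) = c * b w u + b w v.
  by rewrite bC bL !(bC w).
have key s t : 0 <= s ^+ 2 * b x x + 2 * s * t * b x y + t ^+ 2 * b y y.
  have -> : s ^+ 2 * b x x + 2 * s * t * b x y + t ^+ 2 * b y y =
      b (s *: x + (t *: y + 0)) (s *: x + (t *: y + 0)).
    have b0 w : b 0 w = 0.
      by have := bL 1 0 0 w; rewrite scale1r addr0; lra.
    by rewrite !(bL, bR) b0 !(bC _ 0) !b0 (bC y x); ring.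
  exact: b_ge0.
(* The form may be degenerate: [min_quad_eigenvalue] uses it for a singular matrix. If [b y y = 0],
   the value in [key] at [s = b x y], [t = - (b x x + 1)] is [- (b x x + 2) * b x y ^+ 2], which
   forces [b x y = 0]. *)
have [y0|y0] := eqVneq (b y y) 0.
  rewrite y0 mulr0.
  have [->|xy0] := eqVneq (b x y) 0; first by rewrite expr0n.
  have := key (b x y) (- (b x x + 1)); rewrite y0 => h.
  have := b_ge0 x; have : 0 < b x y ^+ 2 by rewrite exprn_even_gt0.
  nra.
have y_gt0 : 0 < b y y by rewrite lt_neqAle eq_sym y0 b_ge0.
have := key (b y y) (- b x y).
have -> : b y y ^+ 2 * b x x + 2 * b y y * - b x y * b x y +
  (- b x y) ^+ 2 * b y y = b y y * (b x x * b y y - b x y ^+ 2) by ring.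
by rewrite pmulr_rge0// subr_ge0.
Qed.

Section Frobenius.
Context {R : realType}.

Lemma frob_dotE p q (A B : 'M[R]_(p, q)) : frob_dot A B = \tr (A^T *m B).
Proof.
rewrite /frob_dot /mxtrace exchange_big/=; apply: eq_bigr => j _.
by rewrite !mxE; apply: eq_bigr => i _; rewrite !mxE.
Qed.

Lemma frob_dotC p q (A B : 'M[R]_(p, q)) : frob_dot A B = frob_dot B A.
Proof. by apply: eq_bigr => i _; apply: eq_bigr => j _; rewrite mulrC. Qed.

Lemma frob_dotDl p q (A B C : 'M[R]_(p, q)) :
  frob_dot (A + B) C = frob_dot A C + frob_dot B C.
Proof. by rewrite !frob_dotE linearD/= mulmxDl linearD. Qed.

Lemma frob_dotZl p q c (A C : 'M[R]_(p, q)) :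
  frob_dot (c *: A) C = c * frob_dot A C.
Proof. by rewrite !frob_dotE linearZ/= -scalemxAl linearZ. Qed.

Lemma frob_dotDr p q (A B C : 'M[R]_(p, q)) :
  frob_dot C (A + B) = frob_dot C A + frob_dot C B.
Proof. by rewrite frob_dotC frob_dotDl !(frob_dotC C). Qed.

Lemma frob_dotZr p q c (A C : 'M[R]_(p, q)) :
  frob_dot C (c *: A) = c * frob_dot C A.
Proof. by rewrite frob_dotC frob_dotZl frob_dotC. Qed.

Lemma frob_dotNl p q (A C : 'M[R]_(p, q)) : frob_dot (- A) C = - frob_dot A C.
Proof. by rewrite -scaleN1r frob_dotZl mulN1r. Qed.

Lemma frob_dotNr p q (A C : 'M[R]_(p, q)) : frob_dot C (- A) = - frob_dot C A.
Proof. by rewrite -scaleN1r frob_dotZr mulN1r. Qed.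

Lemma frob_dot0l p q (C : 'M[R]_(p, q)) : frob_dot 0 C = 0.
Proof. by rewrite -(scale0r 0) frob_dotZl mul0r. Qed.

Lemma frob_dot_ge0 p q (A : 'M[R]_(p, q)) : 0 <= frob_dot A A.
Proof.
by apply: sumr_ge0 => i _; apply: sumr_ge0 => j _; rewrite -expr2 sqr_ge0.
Qed.

Lemma frob_dot_suml p q (I : Type) (r : seq I) (Q : pred I)
    (F : I -> 'M[R]_(p, q)) B :
  frob_dot (\sum_(i <- r | Q i) F i) B = \sum_(i <- r | Q i) frob_dot (F i) B.
Proof.
apply: (big_morph (fun A => frob_dot A B)) => [A C|].
  exact: frob_dotDl.
exact: frob_dot0l.
Qed.

Lemma frob_dot_eq0 p q (A : 'M[R]_(p, q)) : frob_dot A A = 0 -> A = 0.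
Proof.
move=> /eqP; rewrite psumr_eq0; last first.
  by move=> i _; apply: sumr_ge0 => j _; rewrite -expr2 sqr_ge0.
move=> /allP A0; apply/matrixP => i j; rewrite mxE.
have /implyP/(_ isT) := A0 i (mem_index_enum _).
rewrite psumr_eq0; last by move=> k _; rewrite -expr2 sqr_ge0.
move=> /allP/(_ j (mem_index_enum _))/implyP/(_ isT).
by rewrite -expr2 sqrf_eq0 => /eqP.
Qed.

Lemma frob_dot_gt0 p q (A : 'M[R]_(p, q)) : A != 0 -> 0 < frob_dot A A.
Proof.
move=> A0; rewrite lt_neqAle frob_dot_ge0 andbT eq_sym.
by apply: contra A0 => /eqP/frob_dot_eq0/eqP.
Qed.

Lemma frob_dot_mull p q r (A : 'M[R]_(p, q)) (B : 'M[R]_(q, r)) C :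
  frob_dot (A *m B) C = frob_dot B (A^T *m C).
Proof. by rewrite !frob_dotE trmx_mul mulmxA. Qed.

Lemma frob_dot_mulr p q r (A : 'M[R]_(p, q)) (B : 'M[R]_(q, r)) C :
  frob_dot (A *m B) C = frob_dot A (C *m B^T).
Proof. by rewrite !frob_dotE trmx_mul -mulmxA mxtrace_mulC -mulmxA. Qed.

Lemma frob_dot_tr p q (A B : 'M[R]_(p, q)) : frob_dot A^T B^T = frob_dot A B.
Proof.
by rewrite !frob_dotE trmxK -mxtrace_tr trmx_mul !trmxK mxtrace_mulC.
Qed.

(** Cauchy-Schwarz bounds each squared entry of the product by a squared row norm of [A] times a
    squared column norm of [B]; the double sum of these factors. *)
Lemma frob_dot_mul_le p q r (A : 'M[R]_(p, q)) (B : 'M[R]_(q, r)) :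
  frob_dot (A *m B) (A *m B) <= frob_dot A A * frob_dot B B.
Proof.
rewrite -(frob_dot_tr B) {1 2 3}/frob_dot mulr_suml.
apply: ler_sum => i _; rewrite mulr_sumr; apply: ler_sum => j _.
have rowE (M : 'M[R]_(p, q)) (N : 'M[R]_(r, q)) :
    \sum_k M i k * N j k = frob_dot (row i M) (row j N).
  rewrite /frob_dot zmodp.big_ord1; apply: eq_bigr => k _.
  by rewrite !mxE.
have -> : (A *m B) i j = frob_dot (row i A) (row j B^T).
  by rewrite -rowE mxE; apply: eq_bigr => k _; rewrite mxE.
have -> : \sum_k A i k * A i k = frob_dot (row i A) (row i A).
  by rewrite /frob_dot zmodp.big_ord1; apply: eq_bigr => k _; rewrite !mxE.
have -> : \sum_k B^T j k * B^T j k = frob_dot (row j B^T) (row j B^T).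
  by rewrite /frob_dot zmodp.big_ord1; apply: eq_bigr => k _; rewrite !mxE.
rewrite -expr2; apply: cauchy_schwarz.
- exact: frob_dotC.
- by move=> c x y z; rewrite frob_dotDl frob_dotZl.
- exact: frob_dot_ge0.
Qed.

Lemma frob_dot_cs p q (A B : 'M[R]_(p, q)) :
  frob_dot A B ^+ 2 <= frob_dot A A * frob_dot B B.
Proof.
apply: cauchy_schwarz.
- exact: frob_dotC.
- by move=> c x y z; rewrite frob_dotDl frob_dotZl.
- exact: frob_dot_ge0.
Qed.

(** The library norm of a matrix is the entrywise maximum; this Euclidean norm satisfies
    [fnorm_mul_le] and Cauchy-Schwarz without dimensional factors. *)
Definition fnorm p q (A : 'M[R]_(p, q)) : R := Num.sqrt (frob_dot A A).

Lemma fnorm_ge0 p q (A : 'M[R]_(p, q)) : 0 <= fnorm A.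
Proof. exact: sqrtr_ge0. Qed.

Lemma sqr_fnorm p q (A : 'M[R]_(p, q)) : fnorm A ^+ 2 = frob_dot A A.
Proof. by rewrite sqr_sqrtr// frob_dot_ge0. Qed.

Lemma fnorm_mul_le p q r (A : 'M[R]_(p, q)) (B : 'M[R]_(q, r)) :
  fnorm (A *m B) <= fnorm A * fnorm B.
Proof.
rewrite -ler_sqr ?nnegrE ?mulr_ge0 ?fnorm_ge0//.
by rewrite exprMn !sqr_fnorm frob_dot_mul_le.
Qed.

Lemma frob_dot_le_fnorm p q (A B : 'M[R]_(p, q)) :
  `|frob_dot A B| <= fnorm A * fnorm B.
Proof.
rewrite -ler_sqr ?nnegrE ?mulr_ge0 ?fnorm_ge0//.
by rewrite exprMn !sqr_fnorm -normrX ger0_norm ?sqr_ge0// frob_dot_cs.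
Qed.

Lemma fnorm_tr p q (A : 'M[R]_(p, q)) : fnorm A^T = fnorm A.
Proof. by rewrite /fnorm frob_dot_tr. Qed.

Lemma fnormN p q (A : 'M[R]_(p, q)) : fnorm (- A) = fnorm A.
Proof. by rewrite /fnorm frob_dotNl frob_dotNr opprK. Qed.

Lemma fnormZ p q c (A : 'M[R]_(p, q)) : fnorm (c *: A) = `|c| * fnorm A.
Proof.
by rewrite /fnorm frob_dotZl frob_dotZr mulrA -expr2 sqrtrM ?sqr_ge0//
  sqrtr_sqr.
Qed.

Lemma fnormD p q (A B : 'M[R]_(p, q)) : fnorm (A + B) <= fnorm A + fnorm B.
Proof.
rewrite -ler_sqr ?nnegrE ?addr_ge0 ?fnorm_ge0//.
rewrite sqr_fnorm !(frob_dotDl, frob_dotDr) (frob_dotC B A).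
have := ler_norm (frob_dot A B); have := frob_dot_le_fnorm A B.
by rewrite -!sqr_fnorm; nra.
Qed.

Lemma fnorm_sum p q (I : Type) (r : seq I) (F : I -> 'M[R]_(p, q)) :
  fnorm (\sum_(i <- r) F i) <= \sum_(i <- r) fnorm (F i).
Proof.
elim/big_ind2: _ => // [|A a B b Aa Bb].
  by rewrite /fnorm frob_dot0l sqrtr0.
by rewrite (le_trans (fnormD _ _))// lerD.
Qed.

Lemma entry_le_fnorm p q (A : 'M[R]_(p, q)) i j : `|A i j| <= fnorm A.
Proof.
rewrite -ler_sqr ?nnegrE ?fnorm_ge0// sqr_fnorm real_normK ?num_real//.
rewrite /frob_dot (bigD1 i)//= (bigD1 j)//= -expr2 -addrA lerDl.
rewrite addr_ge0//; first by apply: sumr_ge0 => k _; rewrite -expr2 sqr_ge0.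
by apply: sumr_ge0 => k _; apply: sumr_ge0 => l _; rewrite -expr2 sqr_ge0.
Qed.

Lemma fnorm_entry_le p q (A : 'M[R]_(p, q)) (T : R) : 0 <= T ->
  (forall i j, `|A i j| <= T) -> fnorm A <= Num.sqrt (p%:R * (q%:R * T ^+ 2)).
Proof.
move=> T0 AT; apply: ler_wsqrtr.
rewrite !mulr_natl -[in X in X *+ p](card_ord q) -sumr_const.
rewrite -[in leRHS](card_ord p) -sumr_const.
apply: ler_sum => i _; apply: ler_sum => j _.
by rewrite -expr2 -real_normK ?num_real// ler_sqr ?nnegrE.
Qed.

End Frobenius.

(** * Positive definite matrices: Cholesky factors, ln det, the trace of the inverse, least
    eigenvalues *)

Section PositiveDefinite.
Context {R : realType}.

Lemma symmetricmxP n (A : 'M[R]_n) : A \is symmetricmx <-> A^T = A.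
Proof.
split=> [/is_hermitianmxP|A_sym].
  by rewrite expr0 scale1r map_mx_id// => <-.
by apply/is_hermitianmxP; rewrite expr0 scale1r map_mx_id.
Qed.

Lemma quad_formE n (A : 'M[R]_n) (x : 'cV[R]_n) :
  (x^T *m A *m x) 0 0 = frob_dot x (A *m x).
Proof. by rewrite frob_dotE mulmxA /mxtrace big_ord1. Qed.

Lemma posdef_tr n (A : 'M[R]_n) : posdefmx A -> A^T = A.
Proof. by case=> /symmetricmxP. Qed.

Lemma posdef_gt0 n (A : 'M[R]_n) (x : 'cV[R]_n) :
  posdefmx A -> x != 0 -> 0 < frob_dot x (A *m x).
Proof. by move=> [_ A_gt0] /A_gt0; rewrite quad_formE. Qed.

Lemma posdefP n (A : 'M[R]_n) : A^T = A ->
  (forall x : 'cV[R]_n, x != 0 -> 0 < frob_dot x (A *m x)) -> posdefmx A.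
Proof.
by move=> /symmetricmxP A_sym A_gt0; split=> // x x0; rewrite quad_formE A_gt0.
Qed.

Lemma posdef_diag_gt0 n (A : 'M[R]_n) i : posdefmx A -> 0 < A i i.
Proof.
move=> A_pd; have /(posdef_gt0 A_pd) : delta_mx i 0 != 0 :> 'cV[R]_n.
  by apply/eqP => /matrixP/(_ i 0)/eqP; rewrite !mxE !eqxx oner_eq0.
by rewrite frob_dotE mulmxA trmx_delta -rowE -colE /mxtrace big_ord1 !mxE.
Qed.

(** Induction on the dimension: the Schur complement of the upper left entry is again positive
    definite, and its factor completes the block factor of [A]. *)
Lemma posdef_cholesky n (A : 'M[R]_n) :
  posdefmx A -> exists L, is_cholesky A L.
Proof.
elim: n A => [|n IHn] A A_pd.
  exists 0; split; [by apply/is_trig_mxP => -[] | by case |].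
  by apply/matrixP => -[].
pose B : 'M[R]_(1 + n) := A; have B_pd : posdefmx B by [].
pose a := A 0 0; pose v := dlsubmx B.
have a_gt0 : 0 < a by exact: posdef_diag_gt0.
have ulE : ulsubmx B = a%:M.
  by rewrite [LHS]mx11_scalar !mxE; congr ((B _ _)%:M); apply/val_inj.
have urE : ursubmx B = v^T.
  by rewrite /v -[in RHS](posdef_tr B_pd) trmx_dlsub trmxK.
have drE : (drsubmx B)^T = drsubmx B by rewrite trmx_drsub (posdef_tr B_pd).
have BE : B = block_mx a%:M v^T v (drsubmx B).
  by rewrite -ulE -urE submxK.
pose S := drsubmx B - a^-1 *: (v *m v^T).
have S_pd : posdefmx S.
  apply: posdefP => [|x x0].
    by rewrite /S linearB/= drE linearZ/= trmx_mul trmxK.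
  (* This first coordinate minimizes the quadratic form of [B] over all extensions of [x]; the
     minimum is the form of the Schur complement [S] at [x]. *)
  pose c : 'M[R]_1 := - a^-1 *: (v^T *m x).
  have z0 : col_mx c x != 0 by apply: contra x0; rewrite col_mx_eq0 => /andP[].
  have := posdef_gt0 B_pd z0.
  rewrite BE mul_block_col frob_dotE tr_col_mx mul_row_col mxtraceD.
  rewrite mul_scalar_mx /c scalerA mulrN divff ?gt_eqF// scaleN1r addNr mulmx0.
  rewrite mxtrace0 add0r -scalemxAr addrC scaleNr -frob_dotE.
  by rewrite mulmxA scalemxAl -mulmxBl.
have [L [L_trig L_gt0 LE]] := IHn _ S_pd.
pose r := Num.sqrt a; have r_gt0 : 0 < r by rewrite sqrtr_gt0.
have rr : r * r = a by rewrite -expr2 sqr_sqrtr// ltW.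
suff [L' ?] : exists L' : 'M[R]_(1 + n), is_cholesky B L' by exists L'.
exists (block_mx r%:M 0 (r^-1 *: v) L); split.
- by rewrite is_trig_block_mx// eqxx L_trig scalar_mx_is_trig.
- move=> i; case: (split_ordP i) => j ->.
    by rewrite block_mxEul !ord1 mxE eqxx.
  by rewrite block_mxEdr.
- rewrite tr_block_mx mulmx_block BE trmx0 !mul0mx !mulmx0 !addr0.
  rewrite tr_scalar_mx -scalar_mxM rr mul_scalar_mx linearZ/= scalerA.
  rewrite divff ?gt_eqF// scale1r mul_mx_scalar scalerA divff ?gt_eqF//.
  rewrite scale1r -scalemxAl -scalemxAr scalerA -invfM rr LE /S.
  by rewrite addrC subrK.
Qed.

Section Cholesky.
Context {n : nat} {A L : 'M[R]_n}.
Hypothesis AL : is_cholesky A L.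

Lemma cholesky_det_gt0 : 0 < \det L.
Proof. by case: AL => L_trig L_gt0 _; rewrite det_trig// prodr_gt0. Qed.

Lemma cholesky_unitmx : L \in unitmx.
Proof. by rewrite unitmxE unitfE gt_eqF// cholesky_det_gt0. Qed.

Lemma cholesky_det : \det A = \det L ^+ 2.
Proof. by case: AL => _ _ <-; rewrite det_mulmx det_tr. Qed.

Lemma cholesky_inv : invmx A = (invmx L)^T *m invmx L.
Proof.
have L_unit := cholesky_unitmx; case: AL => _ _ <-.
have LT_unit : L^T \in unitmx by rewrite unitmx_tr.
apply: (@can_inj _ _ _ _ (mulKmx (_ : L *m L^T \in unitmx))).
  by rewrite unitmx_mul L_unit.
rewrite mulmxV ?unitmx_mul ?L_unit// trmx_inv mulmxA -(mulmxA L) mulmxV//.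
by rewrite mulmx1 mulmxV.
Qed.

End Cholesky.

Lemma posdef_det_gt0 n (A : 'M[R]_n) : posdefmx A -> 0 < \det A.
Proof.
move=> /posdef_cholesky[L AL].
by rewrite (cholesky_det AL) exprn_gt0// (cholesky_det_gt0 AL).
Qed.

Lemma posdef_unitmx n (A : 'M[R]_n) : posdefmx A -> A \in unitmx.
Proof. by move=> /posdef_det_gt0 A0; rewrite unitmxE unitfE gt_eqF. Qed.

Lemma posdef_congr n (A M : 'M[R]_n) :
  posdefmx A -> M \in unitmx -> posdefmx (M *m A *m M^T).
Proof.
move=> A_pd M_unit; apply: posdefP => [|x x0].
  by rewrite !trmx_mul trmxK (posdef_tr A_pd) mulmxA.
rewrite -!mulmxA -[M in M *m _]trmxK -frob_dot_mull; apply: posdef_gt0 => //.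
apply: contra x0 => /eqP Mx0.
by rewrite -(mulKmx (_ : M^T \in unitmx) x) ?unitmx_tr// Mx0 mulmx0.
Qed.

(** With [A = L L^T], the determinant is the product of the squared diagonal entries of [L], to each
    of which [ln x <= x - 1] applies. The trace is the sum of all squared entries of [L], so it
    dominates the diagonal part. *)
Lemma ln_det_le_tr n (A : 'M[R]_n) : posdefmx A -> ln (\det A) <= \tr A - n%:R.
Proof.
move=> /posdef_cholesky[L [L_trig L_gt0 LA]].
have -> : \det A = \prod_i L i i ^+ 2.
  by rewrite -LA det_mulmx det_tr det_trig// -big_split.
have -> : ln (\prod_i L i i ^+ 2) = \sum_i ln (L i i ^+ 2).
  suff [] : 0 < \prod_i L i i ^+ 2 /\
    ln (\prod_i L i i ^+ 2) = \sum_i ln (L i i ^+ 2) by [].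
  elim: (index_enum _) => [|i s [s0 IHs]]; first by rewrite !big_nil ln1 ltr01.
  by rewrite !big_cons mulr_gt0 ?exprn_gt0// lnM ?posrE ?exprn_gt0// IHs.
rewrite -LA -[L in L *m _]trmxK -frob_dotE frob_dot_tr /frob_dot.
rewrite -[in n%:R](card_ord n) -sumr_const -sumrB; apply: ler_sum => i _.
have : ln (L i i ^+ 2) <= L i i ^+ 2 - 1.
  have := @le_ln1Dx R (L i i ^+ 2 - 1); rewrite addrCA subrr addr0; apply.
  by rewrite ltrBDr addNr exprn_gt0.
move=> /le_trans -> //; rewrite lerD2r (bigD1 i)//= -expr2 lerDl.
by apply: sumr_ge0 => j _; rewrite -expr2 sqr_ge0.
Qed.

Lemma ln_det_supergradient n (Z Y : 'M[R]_n) : posdefmx Z -> posdefmx Y ->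
  ln (\det Y) <= ln (\det Z) + frob_dot (invmx Z) (Y - Z).
Proof.
move=> Z_pd Y_pd; have [L ZL] := posdef_cholesky Z_pd.
have L_unit := cholesky_unitmx ZL.
have LV_unit : invmx L \in unitmx by rewrite unitmx_inv.
have := ln_det_le_tr (posdef_congr Y_pd LV_unit).
have -> : \det (invmx L *m Y *m (invmx L)^T) = \det Y / \det Z.
  rewrite !det_mulmx det_tr det_inv (cholesky_det ZL) -exprVn; ring.
rewrite ln_div ?posrE ?posdef_det_gt0//.
rewrite mxtrace_mulC mulmxA -(cholesky_inv ZL).
rewrite frob_dotE mulmxBr linearB/= trmx_inv (posdef_tr Z_pd).
rewrite mulVmx ?posdef_unitmx// mxtrace1; lra.
Qed.

Lemma invmx_trace n (A L : 'M[R]_n) : is_cholesky A L ->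
  \tr (invmx A) = frob_dot (invmx L) (invmx L).
Proof. by move=> /cholesky_inv ->; rewrite frob_dotE. Qed.

Lemma posdef_inv_trace_ge0 n (A : 'M[R]_n) : posdefmx A -> 0 <= \tr (invmx A).
Proof.
by move=> /posdef_cholesky[L AL]; rewrite (invmx_trace AL) frob_dot_ge0.
Qed.

(** Write [X = L^-T (L^T X)]: the squared norm of [L^-T] is the trace of the inverse, and that of
    [L^T X] is the quadratic form of [A] at [X]. *)
Lemma posdef_lower n p (A : 'M[R]_n) (X : 'M[R]_(n, p)) : posdefmx A ->
  frob_dot X X <= \tr (invmx A) * frob_dot X (A *m X).
Proof.
move=> /posdef_cholesky[L AL]; rewrite (invmx_trace AL).
have L_unit := cholesky_unitmx AL; case: AL => _ _ <-.
rewrite -mulmxA -[L in L *m _]trmxK -frob_dot_mull.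
have {1 2}-> : X = (invmx L)^T *m (L^T *m X).
  by rewrite mulmxA trmx_inv mulVmx ?unitmx_tr// mul1mx.
by rewrite -(frob_dot_tr (invmx L)) frob_dot_mul_le.
Qed.

Lemma posdef_fnorm n (A : 'M[R]_n) : posdefmx A -> fnorm A <= \tr A.
Proof.
move=> /posdef_cholesky[L [_ _ <-]]; rewrite (le_trans (fnorm_mul_le _ _))//.
by rewrite fnorm_tr -expr2 sqr_fnorm -(frob_dot_tr L) frob_dotE trmxK.
Qed.

Lemma posdef_inv_fnorm n (A : 'M[R]_n) :
  posdefmx A -> fnorm (invmx A) <= \tr (invmx A).
Proof.
move=> /posdef_cholesky[L AL]; rewrite (invmx_trace AL) (cholesky_inv AL).
by rewrite (le_trans (fnorm_mul_le _ _))// fnorm_tr -expr2 sqr_fnorm.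
Qed.

Lemma det_le n (A : 'M[R]_n) (T : R) : (forall i j, `|A i j| <= T) ->
  `|\det A| <= n`!%:R * T ^+ n.
Proof.
move=> AT; rewrite /determinant.
apply: (le_trans (ler_norm_sum _ _ _)).
rewrite -perm.card_Sn -sum1_card natr_sum mulr_suml.
apply: ler_sum => s _; rewrite normrM normrX normrN1 expr1n !mul1r normr_prod.
rewrite -[in leRHS](card_ord n) -prodr_const.
by apply: ler_prod => i _; rewrite normr_ge0 AT.
Qed.

(** The inverse is the adjugate over the determinant, and [det_le], from the Leibniz expansion,
    bounds every cofactor by the entries. On superlevel sets this converts a lower bound on the
    determinant into a bound on the inverse. *)
Lemma inv_trace_le n (A : 'M[R]_n) (T d : R) : 0 < d -> d <= \det A ->
  (forall i j, `|A i j| <= T) ->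
  \tr (invmx A) <= n%:R * ((n.-1)`!%:R * T ^+ n.-1) / d.
Proof.
move=> d0 dA AT; have A0 : 0 < \det A := lt_le_trans d0 dA.
rewrite /invmx unitmxE unitfE gt_eqF// mxtraceZ mulrC.
have adj_le : \tr (\adj A) <= n%:R * ((n.-1)`!%:R * T ^+ n.-1).
  rewrite mulr_natl -[X in _ *+ X](card_ord n) -sumr_const.
  apply: ler_sum => i _; rewrite mxE (le_trans (ler_norm _))// /cofactor.
  rewrite normrM normrX normrN1 expr1n mul1r det_le// => k l.
  by rewrite !mxE.
(* Any entry of [A] shows that [T] is nonnegative; for [n = 0] there is no entry, but the factor
   [n%:R] vanishes. *)
have T0 : 0 <= n%:R * ((n.-1)`!%:R * T ^+ n.-1).
  case: n A {dA A0 adj_le} AT => [|n] A AT; first by rewrite mul0r.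
  by rewrite !mulr_ge0// ?exprn_ge0// (le_trans (normr_ge0 _) (AT 0 0)).
rewrite (le_trans (ler_wpM2r _ adj_le)) ?invr_ge0 ?(ltW A0)//.
by rewrite ler_wpM2l// lef_pV2 ?posrE.
Qed.

(* The witness is the largest [t] for which [A - t%:M] is positive semidefinite;
   that matrix is not positive definite, hence singular. *)
Lemma min_quad_eigenvalue n (A : 'M[R]_n) : (0 < n)%N -> A^T = A ->
  exists t, eigenvalue A t /\
    forall x : 'cV[R]_n, t * frob_dot x x <= frob_dot x (A *m x).
Proof.
move=> n_gt0 A_sym.
pose E := [set t | forall x : 'cV[R]_n,
  t * frob_dot x x <= frob_dot x (A *m x)].
have E0 : E (- fnorm A).
  move=> x; rewrite mulNr lerNl (le_trans (ler_norm _))// normrN.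
  rewrite (le_trans (frob_dot_le_fnorm _ _))// mulrC.
  rewrite (le_trans (ler_wpM2r (fnorm_ge0 _) (fnorm_mul_le _ _)))//.
  by rewrite -mulrA -expr2 sqr_fnorm.
pose e : 'cV[R]_n := const_mx 1.
have e_gt0 : 0 < frob_dot e e.
  apply: frob_dot_gt0; apply/eqP => /matrixP/(_ (Ordinal n_gt0) 0)/eqP.
  by rewrite !mxE oner_eq0.
have E_sup : has_sup E.
  split; first by exists (- fnorm A).
  exists (frob_dot e (A *m e) / frob_dot e e) => t /(_ e).
  by rewrite ler_pdivlMr.
pose t := sup E.
have tE : E t.
  move=> x; have [->|x0] := eqVneq x 0.
    by rewrite mulmx0 frob_dot0l mulr0.
  rewrite -ler_pdivlMr ?frob_dot_gt0//; apply: sup_le_ub; first by case: E_sup.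
  by move=> s /(_ x); rewrite -ler_pdivlMr ?frob_dot_gt0.
exists t; split=> //.
pose B := A - t%:M.
have B_sym : B^T = B by rewrite linearB/= A_sym tr_scalar_mx.
have BE (x y : 'cV[R]_n) :
    frob_dot x (B *m y) = frob_dot x (A *m y) - t * frob_dot x y.
  by rewrite mulmxBl mul_scalar_mx frob_dotDr frob_dotNr frob_dotZr.
have B_ge0 (x : 'cV[R]_n) : 0 <= frob_dot x (B *m x) by rewrite BE subr_ge0 tE.
have [x x0 Bx0] : exists2 x : 'cV[R]_n, x != 0 & frob_dot x (B *m x) = 0.
  apply: contrapT => noker.
  have B_pd : posdefmx B.
    apply: posdefP => // x x0; rewrite lt_neqAle B_ge0 andbT eq_sym.
    by apply/eqP => Bx0; apply: noker; exists x.
  (* If [B] were positive definite, [posdef_lower] would put [t + K^-1] in [E], above its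
     supremum. *)
  pose K := \tr (invmx B) + 1.
  have K_gt0 : 0 < K by rewrite ltr_wpDl// posdef_inv_trace_ge0.
  have : E (t + K^-1).
    move=> x; rewrite mulrDl -lerBrDl -BE mulrC ler_pdivrMr// mulrC.
    rewrite (le_trans (posdef_lower x B_pd))// ler_wpM2r//.
    by rewrite lerDl ler01.
  move=> /(sup_upper_bound E_sup); rewrite -/t gerDl.
  by rewrite leNgt invr_gt0 K_gt0.
(* Cauchy-Schwarz for the semidefinite form of [B], at [B *m x] and [x], bounds the square of
   [frob_dot (B *m x) (B *m x)] by a multiple of [frob_dot x (B *m x) = 0]. *)
have Bx : B *m x = 0.
  apply: frob_dot_eq0; apply/eqP; rewrite -sqrf_eq0; apply/eqP/le_anti.
  rewrite sqr_ge0 andbT.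
  have := @cauchy_schwarz R _ (fun y z : 'cV[R]_n => frob_dot y (B *m z))
    _ _ B_ge0 (B *m x) x.
  rewrite Bx0 mulr0; apply.
    by move=> y z; rewrite frob_dotC frob_dot_mull B_sym.
  by move=> c y z w; rewrite frob_dotDl frob_dotZl.
apply/eigenvalueP; exists x^T; last by rewrite trmx_eq0.
apply: trmx_inj; rewrite trmx_mul linearZ/= trmxK A_sym.
by apply/eqP; rewrite -subr_eq0 -mul_scalar_mx -mulmxBl Bx.
Qed.

Lemma eigenvalue_quad n (A : 'M[R]_n) s : A^T = A -> eigenvalue A s ->
  exists2 x : 'cV[R]_n, x != 0 & frob_dot x (A *m x) = s * frob_dot x x.
Proof.
move=> A_sym /eigenvalueP[v vA v0]; exists v^T; first by rewrite trmx_eq0.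
by rewrite -[in A *m _]A_sym -trmx_mul vA linearZ/= frob_dotZr.
Qed.

Lemma min_eigenvalue_exists n (A : 'M[R]_n) : (0 < n)%N -> A^T = A ->
  exists t, is_min_eigenvalue A t.
Proof.
move=> n_gt0 A_sym; have [t [At At_le]] := min_quad_eigenvalue n_gt0 A_sym.
exists t; split=> // s /(eigenvalue_quad A_sym)[x x0 xE].
by rewrite -(ler_pM2r (frob_dot_gt0 x0)) -xE At_le.
Qed.

(** [min_quad_eigenvalue] supplies one eigenvalue with this property, and [t] is at most that
    eigenvalue. *)
Lemma min_eigenvalue_le n (A : 'M[R]_n) t (x : 'cV[R]_n) :
  A^T = A -> is_min_eigenvalue A t ->
  t * frob_dot x x <= frob_dot x (A *m x).
Proof.
move=> A_sym [_ t_min]; case: n A x A_sym t_min => [|n] A x A_sym t_min.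
  by rewrite (flatmx0 x) frob_dot0l frob_dot0l mulr0.
have [s [As As_le]] := min_quad_eigenvalue (ltn0Sn n) A_sym.
by rewrite (le_trans _ (As_le x))// ler_wpM2r ?frob_dot_ge0// t_min.
Qed.

End PositiveDefinite.

(** * Triples, projections and gradients *)

Section Triples.
Context {R : realType} {m n : nat}.
Implicit Types U V W : triple R m n.

Lemma dotC U V : dot U V = dot V U.
Proof. by rewrite /dot !(frob_dotC U.1.1, frob_dotC U.1.2, frob_dotC U.2). Qed.

Lemma dotDl U V W : dot (U + V) W = dot U W + dot V W.
Proof. by rewrite /dot /= !frob_dotDl; ring. Qed.

Lemma dotZl c U V : dot (c *: U) V = c * dot U V.
Proof. by rewrite /dot /= !frob_dotZl !mulrDr. Qed.

Lemma dotNl U V : dot (- U) V = - dot U V.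
Proof. by rewrite -scaleN1r dotZl mulN1r. Qed.

Lemma dot0l U : dot 0 U = 0.
Proof. by rewrite -[X in dot X _](scale0r 0) dotZl mul0r. Qed.

Lemma dotDr U V W : dot W (U + V) = dot W U + dot W V.
Proof. by rewrite dotC dotDl !(dotC W). Qed.

Lemma dotZr c U V : dot V (c *: U) = c * dot V U.
Proof. by rewrite dotC dotZl dotC. Qed.

Lemma dotNr U V : dot V (- U) = - dot V U.
Proof. by rewrite dotC dotNl dotC. Qed.

Lemma dot0r U : dot U 0 = 0.
Proof. by rewrite dotC dot0l. Qed.

Lemma dot_ge0 U : 0 <= dot U U.
Proof. by rewrite /dot !addr_ge0 ?frob_dot_ge0. Qed.

Lemma dot_eq0 U : dot U U = 0 -> U = 0.
Proof.
move=> /eqP; rewrite /dot !paddr_eq0 ?addr_ge0 ?frob_dot_ge0//.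
move=> /andP[/andP[/eqP/frob_dot_eq0 U1 /eqP/frob_dot_eq0 U2]].
by move=> /eqP/frob_dot_eq0 U3; case: U U1 U2 U3 => [[? ?] ?] /= -> -> ->.
Qed.

Lemma dot_cs U V : dot U V ^+ 2 <= dot U U * dot V V.
Proof.
apply: (@cauchy_schwarz R (triple R m n)) => [|c x y z|]; first exact: dotC.
- by rewrite dotDl dotZl.
- exact: dot_ge0.
Qed.

Lemma enorm_ge0 U : 0 <= enorm U.
Proof. exact: sqrtr_ge0. Qed.

Lemma sqr_enorm U : enorm U ^+ 2 = dot U U.
Proof. by rewrite sqr_sqrtr// dot_ge0. Qed.

Lemma enorm_le0 U : (enorm U <= 0) = (U == 0).
Proof.
apply/idP/eqP => [U0|->].
  apply: dot_eq0; rewrite -sqr_enorm; apply/eqP; rewrite sqrf_eq0.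
  by rewrite eq_le U0 enorm_ge0.
by rewrite /enorm dot0l sqrtr0.
Qed.

Lemma dot_le_enorm U V : dot U V <= enorm U * enorm V.
Proof.
rewrite (le_trans (ler_norm _))// -ler_sqr ?nnegrE ?mulr_ge0 ?enorm_ge0//.
by rewrite exprMn !sqr_enorm -normrX ger0_norm ?sqr_ge0// dot_cs.
Qed.

Lemma enormN U : enorm (- U) = enorm U.
Proof. by rewrite /enorm dotNl dotNr opprK. Qed.

Lemma enormZ c U : enorm (c *: U) = `|c| * enorm U.
Proof.
by rewrite /enorm dotZl dotZr mulrA -expr2 sqrtrM ?sqr_ge0// sqrtr_sqr.
Qed.

Lemma enormD U V : enorm (U + V) <= enorm U + enorm V.
Proof.
rewrite -ler_sqr ?nnegrE ?addr_ge0 ?enorm_ge0// sqr_enorm !(dotDl, dotDr).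
have := dot_le_enorm U V; rewrite (dotC V U) -!sqr_enorm; nra.
Qed.

Lemma is_symD U V : Defs.is_sym U -> Defs.is_sym V -> Defs.is_sym (U + V).
Proof.
move=> [/symmetricmxP U1 /symmetricmxP U2] [/symmetricmxP V1 /symmetricmxP V2].
by split; apply/symmetricmxP; rewrite linearD/= ?U1 ?V1 ?U2 ?V2.
Qed.

Lemma is_symZ c U : Defs.is_sym U -> Defs.is_sym (c *: U).
Proof.
move=> [/symmetricmxP U1 /symmetricmxP U2].
by split; apply/symmetricmxP; rewrite linearZ/= ?U1 ?U2.
Qed.

Lemma is_symB U V : Defs.is_sym U -> Defs.is_sym V -> Defs.is_sym (U - V).
Proof. by move=> Us Vs; rewrite -scaleN1r; apply/is_symD/is_symZ. Qed.

Definition convex_subset (O : set (triple R m n)) :=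
  forall U V t, O U -> O V -> 0 <= t <= 1 -> O (U + t *: (V - U)).

(** By minimality [V] is no farther from [U] than [V + t (W - V)]; expanding the squares leaves
    [2 d <= t c], with [d] the left-hand side and [c = |W - V|^2]. *)
Lemma projection_vi (O : set (triple R m n)) U V W : convex_subset O ->
  is_projection O U V -> O W -> dot (U - V) (W - V) <= 0.
Proof.
move=> O_cvx [OV V_min] OW.
have key (t : R) : 0 < t <= 1 ->
    2 * dot (U - V) (W - V) <= t * dot (W - V) (W - V).
  move=> /andP[t0 t1]; rewrite -(ler_pM2l t0).
  have := V_min _ (O_cvx _ _ t OV OW _); rewrite (ltW t0) t1 => /(_ isT).
  rewrite /enorm ler_sqrt ?dot_ge0// opprD addrA -(scaleNr t).
  rewrite !(dotDl (U - V), dotDr (U - V)) !(dotZl, dotZr).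
  by rewrite (dotC (W - V) (U - V)); lra.
rewrite leNgt; apply/negP => d0; have c0 := dot_ge0 (W - V).
set d := dot _ _ in key d0; set c := dot _ _ in key c0.
(* Instead of a limit [t -> 0], the explicit value [t = d / (c + 1)] contradicts [d > 0]; when it
   exceeds 1, [t = 1] already does. *)
have [dc|dc] := leP d (c + 1).
  have c1 : 0 < c + 1 by rewrite ltr_wpDl.
  have : 0 < d / (c + 1) <= 1 by rewrite divr_gt0// ler_pdivrMr ?mul1r.
  move=> /key; rewrite mulrAC ler_pdivlMr ?ltr_wpDl//; nra.
by have := key 1; rewrite ltr01 lexx => /(_ isT); lra.
Qed.

(** The difference of two gradients is itself a symmetric direction. Testing both gradients against
    it shows that its squared norm is zero. *)
Lemma gradientE (f : triple R m n -> R) U G :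
  is_gradient f U G -> gradient f U = G.
Proof.
move=> G_grad; have : is_gradient f U (gradient f U).
  by apply: (@xgetPex _ 0 [set G' | is_gradient f U G']); exists G.
case: G_grad => _ G_sym GE [_ G'_sym G'E].
apply/eqP; rewrite -subr_eq0; apply/eqP/dot_eq0.
have d_sym : Defs.is_sym (gradient f U - G) by exact: is_symB.
by rewrite dotDl dotNl -GE// -G'E// subrr.
Qed.

(** The supergradient inequality bounds the difference quotients above by [dot G V] for [h > 0] and
    below for [h < 0]. Differentiability makes both one-sided limits equal, so the derivative of a
    concave function is found without differentiating a determinant. *)
Lemma is_gradient_of_supergradient (f : triple R m n -> R) U G :
  differentiable f U -> Defs.is_sym G ->
  (forall V, Defs.is_sym V -> exists2 e : R, 0 < e & forall h : R, `|h| < e ->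
     f (h *: V + U) <= f U + h * dot G V) ->
  is_gradient f U G.
Proof.
move=> f_diff G_sym supG; split=> // V /supG[e e0 he].
rewrite -deriveE//; have := @diff_derivable _ _ _ f U V f_diff.
rewrite /derivable /derive.
set q := (fun h : R => _); set l := lim _ => q_cvg.
apply: le_anti; apply/andP; split; rewrite leNgt; apply/negP => lt_l.
  have /nbhs_ballP[d /= d0 hd] :
      nbhs (0 : R) (fun h => h != 0 -> dot G V < q h).
    exact: (cvgr_gt l q_cvg _ lt_l).
  pose h := Num.min (d / 2) (e / 2).
  have h0 : 0 < h by rewrite lt_min !divr_gt0.
  have hld : h < d by rewrite gt_min ltr_pdivrMr// ltr_pMr// ltr1n.
  have hle : h < e by rewrite gt_min orbC ltr_pdivrMr// ltr_pMr// ltr1n.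
  have := hd h; rewrite /ball/= sub0r normrN gtr0_norm// => /(_ hld).
  rewrite gt_eqF// => /(_ isT); rewrite /q/= /GRing.scale/= mulrC.
  rewrite ltr_pdivlMr//; have := he h; rewrite gtr0_norm// => /(_ hle); lra.
have /nbhs_ballP[d /= d0 hd] : nbhs (0 : R) (fun h => h != 0 -> q h < dot G V).
  exact: (cvgr_lt l q_cvg _ lt_l).
pose h := Num.min (d / 2) (e / 2).
have h0 : 0 < h by rewrite lt_min !divr_gt0.
have hld : h < d by rewrite gt_min ltr_pdivrMr// ltr_pMr// ltr1n.
have hle : h < e by rewrite gt_min orbC ltr_pdivrMr// ltr_pMr// ltr1n.
have := hd (- h); rewrite /ball/= sub0r opprK gtr0_norm// => /(_ hld).
rewrite oppr_eq0 gt_eqF// => /(_ isT); rewrite /q/= /GRing.scale/= mulrC.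
rewrite invrN mulrN -mulNr ltr_pdivrMr//.
by have := he (- h); rewrite normrN gtr0_norm// => /(_ hle); lra.
Qed.

End Triples.

(** * Differentiability of expressions built from the coordinates of a triple *)

Section Differentiability.
Context {R : realType}.

Lemma differentiable_bigsum (V : normedModType R) (I : Type) (r : seq I)
    (Q : pred I) (F : I -> V -> R) x :
  (forall i, differentiable (F i) x) ->
  differentiable (fun y => \sum_(i <- r | Q i) F i y) x.
Proof.
move=> F_diff; elim: r => [|i r IHr].
  rewrite (_ : (fun _ => _) = cst 0); first exact: differentiable_cst.
  by apply/funext => y; rewrite big_nil.
rewrite (_ : (fun _ => _) =
  (fun y => if Q i then F i y + \sum_(j <- r | Q j) F j y
            else \sum_(j <- r | Q j) F j y)).
  by case: (Q i) => //; apply: differentiableD.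
by apply/funext => y; rewrite big_cons.
Qed.

Lemma differentiable_bigprod (V : normedModType R) (I : Type) (r : seq I)
    (F : I -> V -> R) x :
  (forall i, differentiable (F i) x) ->
  differentiable (fun y => \prod_(i <- r) F i y) x.
Proof.
move=> F_diff; elim: r => [|i r IHr].
  rewrite (_ : (fun _ => _) = cst 1); first exact: differentiable_cst.
  by apply/funext => y; rewrite big_nil.
rewrite (_ : (fun _ => _) = (fun y => F i y * \prod_(j <- r) F j y)).
  exact: differentiableM.
by apply/funext => y; rewrite big_cons.
Qed.

Lemma differentiable_mull (V : normedModType R) (c : R) (f : V -> R) x :
  differentiable f x -> differentiable (fun y => c * f y) x.
Proof. by move=> f_diff; apply: (@differentiableZ _ _ _ f c). Qed.

Lemma differentiable_det (V : normedModType R) p (F : V -> 'M[R]_p) x :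
  (forall i j, differentiable (fun y => F y i j) x) ->
  differentiable (fun y => \det (F y)) x.
Proof.
move=> F_diff; apply: differentiable_bigsum => s.
by apply: differentiable_mull; apply: differentiable_bigprod.
Qed.

Lemma differentiable_mx_linear (V : normedModType R) p q
    (f : 'M[R]_(p, q) -> R) (F : V -> 'M[R]_(p, q)) x :
  (forall c A B, f (c *: A + B) = c * f A + f B) ->
  (forall i j, differentiable (fun y => F y i j) x) ->
  differentiable (fun y => f (F y)) x.
Proof.
move=> f_lin F_diff; have f0 : f 0 = 0.
  by have := f_lin 1 0 0; rewrite scale1r addr0; lra.
rewrite (_ : (fun y => f (F y)) =
    (fun y => \sum_i \sum_j f (delta_mx i j) * F y i j)).
  apply: differentiable_bigsum => i; apply: differentiable_bigsum => j.
  exact: differentiable_mull.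
apply/funext => y; rewrite {1}(matrix_sum_delta (F y)).
have fD A B : f (A + B) = f A + f B by rewrite -[A]scale1r f_lin mul1r scale1r.
rewrite (big_morph f fD f0); apply: eq_bigr => i _.
rewrite (big_morph f fD f0); apply: eq_bigr => j _.
by rewrite -[X in f X]addr0 f_lin f0 addr0 mulrC.
Qed.

Lemma differentiable_linear_form (V : normedModType R) (f : V -> R) x :
  (forall c u v, f (c *: u + v) = c * f u + f v) -> continuous f ->
  differentiable f x.
Proof.
move=> f_lin f_cont; have f_linear : linear (f : V -> R^o) by [].
pose fM := GRing.isLinear.Build _ _ _ _ _ f_linear.
pose fL : {linear V -> R^o} := HB.pack f fM.
exact: (@linear_differentiable _ _ _ fL).
Qed.

Context {m n : nat}.
Implicit Types U : triple R m n.

Lemma differentiable_coord1 i j U :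
  differentiable (fun V : triple R m n => V.1.1 i j) U.
Proof.
apply: differentiable_linear_form => [c V W|V]; first by rewrite !mxE.
apply: (@cvg_comp _ _ _ (fun W : triple R m n => W.1.1) (fun A => A i j)
  (nbhs V) (nbhs V.1.1)); last exact: coord_continuous.
by apply: (@cvg_comp _ _ _ fst fst (nbhs V) (nbhs V.1)); exact: cvg_fst.
Qed.

Lemma differentiable_coord2 i j U :
  differentiable (fun V : triple R m n => V.1.2 i j) U.
Proof.
apply: differentiable_linear_form => [c V W|V]; first by rewrite !mxE.
apply: (@cvg_comp _ _ _ (fun W : triple R m n => W.1.2) (fun A => A i j)
  (nbhs V) (nbhs V.1.2)); last exact: coord_continuous.
apply: (@cvg_comp _ _ _ fst snd (nbhs V) (nbhs V.1)); first exact: cvg_fst.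
exact: cvg_snd.
Qed.

Lemma differentiable_coord3 i j U :
  differentiable (fun V : triple R m n => V.2 i j) U.
Proof.
apply: differentiable_linear_form => [c V W|V]; first by rewrite !mxE.
apply: (@cvg_comp _ _ _ (fun W : triple R m n => W.2) (fun A => A i j)
  (nbhs V) (nbhs V.2)); last exact: coord_continuous.
exact: cvg_snd.
Qed.

End Differentiability.

(** * The dual objective and its feasible set *)

Section DualObjective.
Context {R : realType} {m n : nat} (P : problem R m n).
Hypothesis C_sym : Cmat P \is symmetricmx.
Hypothesis A_sym : forall i, Amat P i \is symmetricmx.
Implicit Types U V : triple R m n.

Local Notation g := (dual_obj P).

Definition slack U : 'M[R]_n := Cmat P + calB P U.

Lemma dual_objE U : g U = frob_dot (bvec P) U.1.1 +
  mu P * ln (\det (slack U)) + (n%:R * mu P - n%:R * mu P * ln (mu P)).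
Proof. exact: esym (addrA _ _ _). Qed.

(** The adjoint of [calB] for the inner products [frob_dot] and [dot], as [dot_calBadj] shows. *)
Definition calBadj (X : 'M[R]_n) : triple R m n := (- calA P X, 2^-1 *: X, X).

(** Closed form of the gradient. [gradient] is a choice and cannot be computed with; [dual_gradient]
    identifies the two on [Nset]. *)
Definition dual_grad U : triple R m n :=
  (bvec P, 0, 0) + mu P *: calBadj (invmx (slack U)).

Lemma calB_linear c U V : calB P (c *: U + V) = c *: calB P U + calB P V.
Proof.
rewrite /calB /calAT /= !scalerDr scalerN scaler_sumr.
under eq_bigr do rewrite !mxE scalerDl -scalerA.
rewrite big_split/= opprD !scalerA (mulrC _ c); apply/matrixP => i j.
by rewrite !mxE; ring.
Qed.

Lemma calBD U V : calB P (U + V) = calB P U + calB P V.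
Proof. by have := calB_linear 1 U V; rewrite !scale1r. Qed.

Lemma calBZ c U : calB P (c *: U) = c *: calB P U.
Proof.
have B0 : calB P 0 = 0.
  by have := calB_linear 1 0 0; rewrite !scale1r addr0 => /esym/eqP;
     rewrite -subr_eq0 addrK => /eqP.
by rewrite -[X in calB P X]addr0 calB_linear B0 addr0.
Qed.

Lemma slack_line U V t : slack (U + t *: V) = slack U + t *: calB P V.
Proof. by rewrite /slack calBD calBZ addrA. Qed.

Lemma slackB U V : slack V - slack U = calB P (V - U).
Proof.
by rewrite /slack opprD addrACA subrr add0r -[- U]scaleN1r calBD calBZ scaleN1r.
Qed.

Lemma calB_tr U : Defs.is_sym U -> (calB P U)^T = calB P U.
Proof.
move=> [/symmetricmxP U1 /symmetricmxP U2].
rewrite /calB /calAT !linearD/= linearN/= linear_sum/= linearZ/= U1 U2.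
congr (- _ + _ + _); apply: eq_bigr => i _; rewrite linearZ/=.
by have /symmetricmxP -> := A_sym i.
Qed.

Lemma slack_tr U : Defs.is_sym U -> (slack U)^T = slack U.
Proof.
by move=> U_sym; rewrite linearD/= calB_tr//; have /symmetricmxP -> := C_sym.
Qed.

Lemma dot_calBadj (X : 'M[R]_n) U :
  frob_dot X (calB P U) = dot (calBadj X) U.
Proof.
rewrite /calB /dot /= !frob_dotDr frob_dotNr frob_dotNl frob_dotZr frob_dotZl.
congr (- _ + _ + _); rewrite frob_dotC frob_dot_suml /frob_dot.
apply: eq_bigr => i _; rewrite zmodp.big_ord1 !mxE mulrC.
by have := frob_dotZl (U.1.1 i 0) (Amat P i) X; rewrite mulrC.
Qed.

Lemma calBadj_sym (X : 'M[R]_n) : X^T = X -> Defs.is_sym (calBadj X).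
Proof.
by move=> X_sym; split; apply/symmetricmxP; rewrite //= linearZ/= X_sym.
Qed.

Lemma dual_grad_sym U : Nset P U -> Defs.is_sym (dual_grad U).
Proof.
move=> [U_sym S_pd]; apply: is_symD.
  by split; apply/symmetricmxP; rewrite /= linear0.
by apply/is_symZ/calBadj_sym; rewrite trmx_inv slack_tr.
Qed.

Lemma dual_grad_dot U V : dot (dual_grad U) V =
  frob_dot (bvec P) V.1.1 + mu P * frob_dot (invmx (slack U)) (calB P V).
Proof.
rewrite dotDl dotZl dot_calBadj; congr (_ + _).
by rewrite /dot /= !frob_dot0l !addr0.
Qed.

Lemma dual_supergradient U V : 0 <= mu P -> Nset P U -> Nset P V ->
  g V <= g U + dot (dual_grad U) (V - U).
Proof.
move=> mu_ge0 [_ U_pd] [_ V_pd].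
have key : mu P * ln (\det (slack V)) <= mu P * ln (\det (slack U)) +
    mu P * frob_dot (invmx (slack U)) (slack V - slack U).
  by rewrite -mulrDr ler_wpM2l// ln_det_supergradient.
rewrite dual_grad_dot -slackB !dual_objE.
have -> : (V - U).1.1 = V.1.1 - U.1.1 by [].
rewrite frob_dotDr frob_dotNr; move: key.
move: (frob_dot _ V.1.1) (frob_dot _ U.1.1) (mu P * ln (\det (slack V))).
move: (mu P * ln (\det (slack U))) (mu P * frob_dot _ _) (n%:R * _ - _).
by move=> a b c d e f; lra.
Qed.

(** [posdef_lower] bounds [|x|^2] by [K] times the form of [Z], while the form of [B] is at most
    [fnorm B * |x|^2]; hence [|h| * K * fnorm B < 1] suffices. *)
Lemma posdef_perturb (Z B : 'M[R]_n) : posdefmx Z -> B^T = B ->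
  exists2 e : R, 0 < e & forall h : R, `|h| < e -> posdefmx (Z + h *: B).
Proof.
move=> Z_pd B_sym; pose K := \tr (invmx Z) + 1.
have K_gt0 : 0 < K by rewrite ltr_wpDl// posdef_inv_trace_ge0.
have B_ge0 := fnorm_ge0 B.
have B_gt0 : 0 < fnorm B + 1 by rewrite ltr_wpDl.
exists (K * (fnorm B + 1))^-1 => [|h]; first by rewrite invr_gt0 mulr_gt0.
rewrite -[_^-1]mul1r ltr_pdivlMr ?mulr_gt0// => hK.
apply: posdefP => [|x x0].
  by rewrite linearD linearZ/= B_sym (posdef_tr Z_pd).
rewrite mulmxDl frob_dotDr -scalemxAl frob_dotZr.
have x_gt0 := frob_dot_gt0 x0; have Zx_gt0 := posdef_gt0 Z_pd x0.
have Kx : frob_dot x x <= K * frob_dot x (Z *m x).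
  by rewrite (le_trans (posdef_lower x Z_pd))// ler_wpM2r ?(ltW Zx_gt0)// lerDl.
have Bx : `|frob_dot x (B *m x)| <= fnorm B * frob_dot x x.
  rewrite (le_trans (frob_dot_le_fnorm _ _))// -sqr_fnorm expr2 mulrA.
  by rewrite [leRHS]mulrC ler_wpM2l ?fnorm_ge0// fnorm_mul_le.
have hBx : `|h * frob_dot x (B *m x)| <= `|h| * (fnorm B * frob_dot x x).
  by rewrite normrM ler_wpM2l.
have hx : K * (`|h| * (fnorm B * frob_dot x x)) < frob_dot x x.
  rewrite -[ltRHS]mul1r !mulrA ltr_pM2r//.
  by apply: le_lt_trans hK; have := normr_ge0 h; nra.
have : K * (`|h| * (fnorm B * frob_dot x x)) < K * frob_dot x (Z *m x).
  exact: lt_le_trans hx Kx.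
rewrite ltr_pM2l// => lt_Zx.
have := ler_norm (- (h * frob_dot x (B *m x))); rewrite normrN; lra.
Qed.

Lemma Nset_perturb U V : Nset P U -> Defs.is_sym V ->
  exists2 e : R, 0 < e & forall h : R, `|h| < e -> Nset P (h *: V + U).
Proof.
move=> [U_sym U_pd] V_sym.
have [e e0 he] := posdef_perturb U_pd (calB_tr V_sym).
exists e => // h /he h_pd; split; first by apply: is_symD => //; apply: is_symZ.
by rewrite (addrC (h *: V)); have := slack_line U V h; rewrite /slack => ->.
Qed.

(** [is_gradient] asks for differentiability in all directions, symmetric or not. The determinant of
    the slack is a polynomial in the coordinates and positive at [U], where [ln] is
    differentiable. *)
Lemma dual_obj_differentiable U : Nset P U -> differentiable g U.
Proof.
move=> [_ U_pd].
have slack_diff i j : differentiable (fun V : triple R m n => slack V i j) U.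
  rewrite (_ : (fun _ => _) = (fun V : triple R m n =>
      (Cmat P i j + - (\sum_k Amat P k i j * V.1.1 k 0))
      + (2^-1 * V.1.2 i j + V.2 i j))); last first.
    apply/funext => V; rewrite !mxE summxE -!addrA; congr (_ + (- _ + _)).
    by apply: eq_bigr => k _; rewrite mxE mulrC.
  apply: differentiableD; last apply: differentiableD.
  - apply: differentiableD; first exact: differentiable_cst.
    apply: differentiableN; apply: differentiable_bigsum => k.
    exact/differentiable_mull/differentiable_coord1.
  - exact/differentiable_mull/differentiable_coord2.
  - exact: differentiable_coord3.
have b_diff :
    differentiable (fun V : triple R m n => frob_dot (bvec P) V.1.1) U.
  apply: (@differentiable_mx_linear _ _ _ _ (frob_dot (bvec P))
    (fun V => V.1.1)).
    by move=> c A B; rewrite frob_dotDr frob_dotZr.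
  by move=> i j; exact: differentiable_coord1.
have ln_diff : differentiable (fun V : triple R m n => ln (\det (slack V))) U.
  apply: (@differentiable_comp _ _ _ _ (fun V => \det (slack V)) (@ln R)).
    exact: differentiable_det.
  apply/derivable1_diffP; apply: ex_derive; apply: is_derive1_ln.
  exact: posdef_det_gt0.
rewrite (_ : g = (fun V : triple R m n => (frob_dot (bvec P) V.1.1 +
    mu P * ln (\det (slack V))) + (n%:R * mu P - n%:R * mu P * ln (mu P)))).
  apply: differentiableD; last exact: differentiable_cst.
  by apply: differentiableD => //; exact: differentiable_mull.
by apply/funext => V; rewrite dual_objE.
Qed.

Lemma dual_gradient U : 0 <= mu P -> Nset P U ->
  gradient g U = dual_grad U.
Proof.
move=> mu_ge0 UN; apply/gradientE/is_gradient_of_supergradient.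
- exact: dual_obj_differentiable.
- exact: dual_grad_sym.
- move=> V V_sym; have [e e0 he] := Nset_perturb UN V_sym.
  exists e => // h /he VN.
  by have := dual_supergradient mu_ge0 UN VN; rewrite addrK dotZr.
Qed.

End DualObjective.

(** * Symmetry and convexity of [Mset] *)

Section FeasibleSet.
Context {R : realType} {m n : nat} (P : problem R m n).
Implicit Types U V : triple R m n.

Lemma mx_norm_leP p q (A : 'M[R]_(p, q)) (c : R) : 0 <= c ->
  `|A| <= c <-> forall i j, `|A i j| <= c.
Proof.
move=> c0; rewrite /Num.norm/= mx_normrE; split=> [Ac i j|Ac].
  by apply: le_trans Ac; apply: (le_bigmax _ (fun ij => `|A ij.1 ij.2|) (i, j)).
by apply: bigmax_le => // -[i j] _; exact: Ac.
Qed.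

Lemma QT_linear c (Z Z' : 'M[R]_(nbar n)) :
  QT P (c *: Z + Z') = c *: QT P Z + QT P Z'.
Proof.
have E a : QT_entry (c *: Z + Z') a = c * QT_entry Z a + QT_entry Z' a.
  rewrite /QT_entry; under eq_bigr do rewrite !mxE.
  under [X in _ - X]eq_bigr do rewrite !mxE.
  by rewrite !big_split/= -!mulr_sumr; ring.
apply/matrixP => i j; rewrite !mxE.
case: insub => [p|]; rewrite ?E//.
by case: insub => [p|]; rewrite ?E// mulr0 addr0.
Qed.

Lemma QTZ c (Z : 'M[R]_(nbar n)) : QT P (c *: Z) = c *: QT P Z.
Proof.
have QT0 : QT P 0 = 0.
  have := QT_linear 1 0 0; rewrite !scale1r addr0 => /esym/eqP.
  by rewrite -subr_eq0 addrK => /eqP.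
by rewrite -[X in QT P X]addr0 QT_linear QT0 addr0.
Qed.

Lemma QT_tr (Z : 'M[R]_(nbar n)) : (QT P Z)^T = QT P Z.
Proof.
apply/matrixP => i j; rewrite !mxE.
have [ij|ij|/val_inj ij] := ltngtP i j; last by rewrite ij.
  have jiF : ~~ ((j, i).1 < (j, i).2)%N by rewrite /= -leqNgt ltnW.
  by rewrite (@insubN _ (fun p : 'I_n * 'I_n => p.1 < p.2)%N (upper_pair n)
    _ jiF).
have ijF : ~~ ((i, j).1 < (i, j).2)%N by rewrite /= -leqNgt ltnW.
by rewrite (@insubN _ (fun p : 'I_n * 'I_n => p.1 < p.2)%N (upper_pair n)
  _ ijF).
Qed.

Lemma QT_le (Z : 'M[R]_(nbar n)) (c : R) i j : 0 <= c ->
  (forall k l, `|Z k l| <= c) ->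
  `|QT P Z i j| <= (nbar n)%:R * c + (nbar n)%:R * c.
Proof.
move=> c0 Zc; have Nc : 0 <= (nbar n)%:R * c by rewrite mulr_ge0.
have sum_le (Q : pred 'I_(nbar n)) F : (forall l, `|F l| <= c) ->
    `|\sum_(l | Q l) F l| <= (nbar n)%:R * c.
  move=> Fc; rewrite (le_trans (ler_norm_sum _ _ _))//.
  rewrite mulr_natl -[X in _ *+ X]card_ord -sumr_const big_mkcond/=.
  by apply: ler_sum => l _; case: ifP.
have E a : `|QT_entry Z a| <= (nbar n)%:R * c + (nbar n)%:R * c.
  by rewrite (le_trans (ler_normB _ _))// lerD// sum_le.
rewrite mxE; case: insub => [p|//]; first exact: E.
by case: insub => [p|]; [exact: E | rewrite normr0 addr_ge0].
Qed.

Lemma Mset_sym U : Mset P U -> Defs.is_sym U.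
Proof.
move=> [[W_sym _] [Z _ ZE]]; split=> //.
by apply/symmetricmxP; rewrite -ZE QT_tr.
Qed.

Lemma Mset_convex : convex_subset (Mset P).
Proof.
move=> U V t [[UWs UW] [Z [Zs Zl] ZE]] [[VWs VW] [Z' [Zs' Zl'] ZE']].
move=> /andP[t0 t1]; have t1' : 0 <= 1 - t by rewrite subr_ge0.
have cvx p q (A B : 'M[R]_(p, q)) c : `|A| <= c -> `|B| <= c ->
    `|A + t *: (B - A)| <= c.
  move=> Ac Bc; have -> : A + t *: (B - A) = (1 - t) *: A + t *: B.
    by apply/matrixP => i j; rewrite !mxE; ring.
  rewrite (le_trans (ler_normD _ _))// !normrZ (ger0_norm t0) (ger0_norm t1').
  nra.
have sym k (A B : 'M[R]_k) : A \is symmetricmx -> B \is symmetricmx ->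
    A + t *: (B - A) \is symmetricmx.
  move=> /symmetricmxP As /symmetricmxP Bs; apply/symmetricmxP.
  by rewrite linearD/= linearZ/= linearB/= As Bs.
split; first by split; [exact: sym | exact: cvx].
exists (Z + t *: (Z' - Z)); first by split; [exact: sym | exact: cvx].
have -> : Z + t *: (Z' - Z) = t *: Z' + (1 - t) *: Z.
  by apply/matrixP => i j; rewrite !mxE; ring.
rewrite QT_linear QTZ ZE ZE' /=.
by apply/matrixP => i j; rewrite !mxE; ring.
Qed.

End FeasibleSet.

(** * Existence of the projection onto [Mset] *)

Section ProjectionExists.
Context {R : realType} {m n : nat} (P : problem R m n).
Implicit Types U V : triple R m n.

(** The distance is minimized over the parameter [Z], which ranges over a box, rather than over the
    image under [QT]; the extreme value theorem on the box applies. *)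
Lemma QT_nearest (S : 'M[R]_n) : 0 <= lambda P ->
  exists2 Z : 'M[R]_(nbar n), Z \is symmetricmx /\ `|Z| <= lambda P &
    forall Z' : 'M[R]_(nbar n), Z' \is symmetricmx /\ `|Z'| <= lambda P ->
      frob_dot (S - QT P Z) (S - QT P Z) <=
      frob_dot (S - QT P Z') (S - QT P Z').
Proof.
set N := nbar n; move=> lambda_ge0.
pose A := [set v : 'rV[R]_(N * N) |
  forall i, `[- lambda P, lambda P]%classic (v 0 i)].
(* Symmetrizing [vec_mx v] turns the box of symmetric matrices into the image
   of a compact box of row vectors. *)
pose symm (v : 'rV[R]_(N * N)) : 'M[R]_N := 2^-1 *: (vec_mx v + (vec_mx v)^T).
have symm_linear c u v : symm (c *: u + v) = c *: symm u + symm v.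
  rewrite /symm linearP/= linearP/=.
  by apply/matrixP => i j; rewrite !mxE; ring.
pose f (v : 'rV[R]_(N * N)) :=
  frob_dot (S - QT P (symm v)) (S - QT P (symm v)).
have A0 : A !=set0.
  by exists 0 => i /=; rewrite mxE in_itv/= oppr_le0 lambda_ge0.
have A_compact : compact A.
  by have := @rV_compact _ (N * N)%N (fun=> `[- lambda P, lambda P]%classic)
    (fun=> @segment_compact _ _ _).
have f_cont : {within A, continuous f}.
  apply: continuous_subspaceT => v; apply: differentiable_continuous.
  have E_diff i j : differentiable (fun v => (S - QT P (symm v)) i j) v.
    rewrite (_ : (fun _ => _) = (fun v => S i j + - QT P (symm v) i j)).
      apply: differentiableD; first exact: differentiable_cst.
      apply: differentiableN.
      apply: (@differentiable_mx_linear _ _ _ _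
        (fun u => QT P (symm u) i j) id).
        by move=> c u w; rewrite symm_linear QT_linear !mxE.
      by move=> k l; exact: differentiable_coord.
    by apply/funext => w; rewrite !mxE.
  apply: differentiable_bigsum => i; apply: differentiable_bigsum => j.
  exact: differentiableM.
have [v vA v_min] := EVT_min_rV A0 A_compact f_cont.
exists (symm v).
  split; first by apply/symmetricmxP; rewrite linearZ/= linearD/= trmxK addrC.
  apply/mx_norm_leP => // i j; move: vA; rewrite inE => vA.
  have := vA (mxvec_index i j); have := vA (mxvec_index j i).
  rewrite /= !in_itv/= !mxE ler_norml => /andP[? ?] /andP[? ?].
  by apply/andP; split; lra.
move=> Z' [/symmetricmxP Z'_sym /(mx_norm_leP Z' lambda_ge0) Z'_le].
have symmZ' : symm (mxvec Z') = Z'.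
  rewrite /symm mxvecK Z'_sym; apply/matrixP => i j; rewrite !mxE.
  by field.
rewrite -symmZ'; apply: v_min; rewrite inE => k.
case/mxvec_indexP: k => i j.
by rewrite /= mxvecE in_itv/= -ler_norml Z'_le.
Qed.

(** The squared distance is a sum over the three components, so each is projected alone: the first
    is free, the second is clipped entrywise to [[- rho, rho]], which preserves symmetry, and the
    third is [QT_nearest]. *)
Lemma Mset_projection U : 0 <= rho P -> 0 <= lambda P -> Defs.is_sym U ->
  is_projection (Mset P) U (projection (Mset P) U).
Proof.
move=> rho_ge0 lambda_ge0 [/symmetricmxP U1_sym _].
suff [V V_proj] : exists V, is_projection (Mset P) U V.
  by apply: (@xgetPex _ 0 [set V | is_projection (Mset P) U V]); exists V.
have [Z Z_box Z_min] := QT_nearest U.2 lambda_ge0.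
pose clip (x : R) := Num.min (rho P) (Num.max (- rho P) x).
have clip_le x : `|clip x| <= rho P.
  rewrite /clip ler_norml; have [?|/ltW ?] := leP (- rho P) x;
  have [?|/ltW ?] := leP (rho P); apply/andP; split; lra.
have clip_min x w : `|w| <= rho P ->
    (x - clip x) * (x - clip x) <= (x - w) * (x - w).
  rewrite /clip ler_norml => /andP[? ?].
  have [?|/ltW ?] := leP (- rho P) x; have [?|/ltW ?] := leP (rho P).
  - rewrite -subr_ge0; have -> : (x - w) * (x - w) - (x - rho P) * (x - rho P) =
      (rho P - w) * ((x - rho P) + (x - w)) by ring.
    by apply: mulr_ge0; lra.
  - by rewrite subrr mul0r -expr2 sqr_ge0.
  - by have -> : w = rho P by lra.
  - rewrite -subr_ge0.
    have -> : (x - w) * (x - w) - (x - - rho P) * (x - - rho P) =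
      (w + rho P) * ((w - x) + (- rho P - x)) by ring.
    by apply: mulr_ge0; lra.
pose W : 'M[R]_n := \matrix_(i, j) clip (U.1.2 i j).
exists (U.1.1, W, QT P Z); split.
  split; last by exists Z.
  split; first by apply/symmetricmxP/matrixP => i j;
    rewrite !mxE -[in RHS]U1_sym mxE.
  by apply/mx_norm_leP => // i j; rewrite mxE clip_le.
move=> V [[_ /(mx_norm_leP _ rho_ge0) V_le] [Z' Z'_box Z'E]].
rewrite /enorm ler_sqrt ?dot_ge0// /dot /= subrr frob_dot0l add0r.
rewrite -Z'E lerD ?Z_min// ler_wpDl ?frob_dot_ge0//.
by apply: ler_sum => i _; apply: ler_sum => j _; rewrite !mxE clip_min.
Qed.

End ProjectionExists.

(** * Boundedness of the superlevel sets of the dual objective *)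

Section LevelSets.
Context {R : realType} {m n : nat} (P : problem R m n).
Implicit Types U V : triple R m n.

Lemma Mset_bounded : 0 <= rho P -> 0 <= lambda P -> exists2 K, 0 <= K &
  forall U, Mset P U -> fnorm U.1.2 <= K /\ fnorm U.2 <= K.
Proof.
move=> rho_ge0 lambda_ge0.
pose bound (c : R) := Num.sqrt (n%:R * (n%:R * c ^+ 2)).
pose s := (nbar n)%:R * lambda P + (nbar n)%:R * lambda P.
have s_ge0 : 0 <= s by rewrite addr_ge0// mulr_ge0.
exists (bound (rho P) + bound s); first by rewrite addr_ge0// sqrtr_ge0.
move=> U [[_ /(mx_norm_leP _ rho_ge0) UW]].
move=> [Z [_ /(mx_norm_leP _ lambda_ge0) Zl] ZE].
split.
  by rewrite (le_trans (fnorm_entry_le rho_ge0 UW))// lerDl sqrtr_ge0.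
rewrite -ZE (le_trans (@fnorm_entry_le _ _ _ _ s s_ge0 _))//
  ?lerDr ?sqrtr_ge0//.
by move=> i j; exact: QT_le.
Qed.

Lemma enorm_le_fnorm U : enorm U <= fnorm U.1.1 + fnorm U.1.2 + fnorm U.2.
Proof.
have h1 := fnorm_ge0 U.1.1; have h2 := fnorm_ge0 U.1.2.
have h3 := fnorm_ge0 U.2.
rewrite -ler_sqr ?nnegrE ?enorm_ge0 ?addr_ge0// sqr_enorm /dot -!sqr_fnorm.
by have := mulr_ge0 h1 h2; have := mulr_ge0 h1 h3; have := mulr_ge0 h2 h3; nra.
Qed.

(** [ln_det_le_tr] for [s *: Z]. A small [s] makes the coefficient of the trace as small as needed,
    so that a linear term can absorb the logarithm. *)
Lemma ln_det_le_scaled (Z : 'M[R]_n) s : 0 < s -> posdefmx Z ->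
  ln (\det Z) <= s * \tr Z - n%:R - n%:R * ln s.
Proof.
move=> s0 Z_pd; have sZ_pd : posdefmx (s *: Z).
  apply: posdefP => [|x x0]; first by rewrite linearZ/= (posdef_tr Z_pd).
  by rewrite -scalemxAl frob_dotZr mulr_gt0// posdef_gt0.
have := ln_det_le_tr sZ_pd.
rewrite detZ lnM ?posrE ?exprn_gt0 ?posdef_det_gt0// lnXn// mxtraceZ.
by rewrite -mulr_natl; lra.
Qed.

(** The adjoint identity solved for the first component. It serves twice: a Slater point [X] gives
    [b^T y], and preimages of unit vectors give the single coordinates of [y]. *)
Lemma calA_dot (X : 'M[R]_n) U : frob_dot (calA P X) U.1.1 =
  2^-1 * frob_dot X U.1.2 + frob_dot X U.2 - frob_dot X (slack P U)
  + frob_dot X (Cmat P).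
Proof.
have := dot_calBadj P X U; rewrite /dot /= frob_dotNl frob_dotZl.
by rewrite /slack frob_dotDr; lra.
Qed.

(** For a Slater point [X] the objective is at most a constant minus [<X, Z>] plus [mu ln det Z],
    and the logarithm is at most half of [<X, Z>] plus a constant. A lower bound on the objective
    therefore bounds [<X, Z>], hence [Z], and bounds the determinant of [Z] away from zero. *)
Lemma level_set_bounded (c : R) : 0 < mu P -> 0 <= rho P -> 0 <= lambda P ->
  A_surjective P -> primal_slater P ->
  exists2 T, 0 <= T & forall U, Mset P U -> Nset P U -> c <= dual_obj P U ->
    \tr (invmx (slack P U)) <= T /\ enorm U <= T.
Proof.
move=> mu_gt0 rho_ge0 lambda_ge0 A_surj [X X_pd XE].
have [K K0 MK] := Mset_bounded rho_ge0 lambda_ge0.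
pose k := \tr (invmx X) + 1.
have k0 : 0 < k by rewrite ltr_wpDl ?posdef_inv_trace_ge0.
(* Chosen so that [mu * s * \tr Z <= mu * s * k * <X, Z> = <X, Z> / 2]. *)
pose s := (2 * mu P * k)^-1.
have s0 : 0 < s by rewrite invr_gt0 !mulr_gt0.
pose D := 2^-1 * K + K + fnorm (Cmat P).
have D_le (Y : 'M[R]_n) U : Mset P U -> `|2^-1 * frob_dot Y U.1.2
    + frob_dot Y U.2 + frob_dot Y (Cmat P)| <= fnorm Y * D.
  move=> /MK[UW US].
  have := frob_dot_le_fnorm Y U.1.2; have := frob_dot_le_fnorm Y U.2.
  have := frob_dot_le_fnorm Y (Cmat P).
  have := ler_wpM2l (fnorm_ge0 Y) UW; have := ler_wpM2l (fnorm_ge0 Y) US.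
  rewrite /D !ler_norml !mulrDr => ? ? /andP[? ?] /andP[? ?] /andP[? ?].
  by apply/andP; split; lra.
pose c1 := fnorm X * D + (n%:R * mu P - n%:R * mu P * ln (mu P)).
pose c2 := mu P * (- n%:R - n%:R * ln s).
(* [c <= c1 + c2 - <X, Z> / 2] on the superlevel set, so [T1] bounds [<X, Z>] and [T2] bounds the
   trace of [Z]; [d] will bound its determinant below. *)
pose T1 := 2 * (c1 + c2 - c); pose T2 := k * `|T1|.
pose d := expR ((c - c1) / mu P).
(* Surjectivity is used here: each coordinate of [y] becomes a pairing of [Y i] with the bounded
   matrices of [calA_dot]. *)
have /choice[Y YE] : forall i : 'I_m, exists Y : 'M[R]_n,
    calA P Y = delta_mx i 0.
  by move=> i; have [Y _ YE] := A_surj (delta_mx i 0); exists Y.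
have T2_ge0 : 0 <= T2 by rewrite mulr_ge0// ltW.
have D_ge0 : 0 <= D by rewrite !addr_ge0 ?mulr_ge0 ?invr_ge0 ?fnorm_ge0.
pose T3 := \sum_j fnorm (Y j) * (D + T2).
have T3_ge0 : 0 <= T3.
  apply: sumr_ge0 => j _; apply: mulr_ge0; first exact: fnorm_ge0.
  exact: addr_ge0.
pose T4 := n%:R * ((n.-1)`!%:R * T2 ^+ n.-1) / d.
have T4_ge0 : 0 <= T4 by rewrite !mulr_ge0 ?exprn_ge0// invr_ge0 expR_ge0.
pose T5 := Num.sqrt (m%:R * (1 * T3 ^+ 2)) + K + K.
have T5_ge0 : 0 <= T5 by rewrite !addr_ge0 ?sqrtr_ge0.
exists (T4 + T5) => [|U UM [U_sym Z_pd] gU]; first exact: addr_ge0.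
change (posdefmx (slack P U)) in Z_pd.
set Z := slack P U in Z_pd *.
(* With [Z = L L^T], the trace is [frob_dot L L] and [<X, Z>] is the form of [X] at [L], so
   [posdef_lower] for [X] compares them. *)
have [trZ XZ_ge0] : \tr Z <= k * frob_dot X Z /\ 0 <= frob_dot X Z.
  have [L [_ _ LE]] := posdef_cholesky Z_pd.
  have trE : \tr Z = frob_dot L L by rewrite -LE mxtrace_mulC frob_dotE.
  have XZE : frob_dot X Z = frob_dot L (X *m L).
    by rewrite -LE [RHS]frob_dotC frob_dot_mulr.
  have XZ_ge0 : 0 <= frob_dot X Z.
    have [M [_ _ <-]] := posdef_cholesky X_pd.
    by rewrite -LE -frob_dot_mulr -mulmxA frob_dot_mull frob_dot_ge0.
  split=> //; rewrite trE (le_trans (posdef_lower L X_pd))// -XZE.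
  by rewrite ler_wpM2r// lerDl.
have g_le : dual_obj P U <= c1 - frob_dot X Z + mu P * ln (\det Z).
  rewrite dual_objE -XE calA_dot -/Z /c1.
  by have := le_trans (ler_norm _) (D_le X U UM); lra.
have ln_le : mu P * ln (\det Z) <= 2^-1 * frob_dot X Z + c2.
  have := ler_wpM2l (ltW mu_gt0) (ln_det_le_scaled s0 Z_pd).
  have : mu P * (s * \tr Z) <= 2^-1 * frob_dot X Z.
    rewrite mulrA; have -> : mu P * s = 2^-1 / k.
      by rewrite /s; field; rewrite !gt_eqF.
    by rewrite -mulrA ler_wpM2l ?invr_ge0// ler_pdivrMl.
  by rewrite /c2 !mulrBr !mulrN; lra.
have XZ_le : frob_dot X Z <= `|T1|.
  by apply: le_trans (ler_norm _); rewrite /T1; lra.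
have trZ_le : \tr Z <= T2 by rewrite (le_trans trZ)// ler_wpM2l// ltW.
have fZ_le : fnorm Z <= T2 := le_trans (posdef_fnorm Z_pd) trZ_le.
have det_ge : d <= \det Z.
  rewrite -[\det Z]lnK ?posrE ?posdef_det_gt0// ler_expR ler_pdivrMr//.
  by rewrite mulrC; lra.
split.
  rewrite (le_trans (@inv_trace_le _ _ Z T2 d _ _ _)) ?expR_gt0 ?lerDl//.
  by move=> i j; rewrite (le_trans (entry_le_fnorm _ _ _)).
have y_le i j : `|U.1.1 i j| <= T3.
  have -> : U.1.1 i j = frob_dot (calA P (Y i)) U.1.1.
    rewrite YE frob_dotE trmx_delta -rowE /mxtrace zmodp.big_ord1 mxE.
    by rewrite (ord1 j).
  rewrite calA_dot -/Z.
  have YZ : `|frob_dot (Y i) Z| <= fnorm (Y i) * T2.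
    by rewrite (le_trans (frob_dot_le_fnorm _ _))// ler_wpM2l ?fnorm_ge0.
  apply: (@le_trans _ _ (fnorm (Y i) * (D + T2))).
    rewrite mulrDr addrAC (le_trans (ler_normB _ _))// lerD//.
    exact: D_le.
  rewrite /T3 (bigD1 i)//= lerDl sumr_ge0// => l _.
  by apply: mulr_ge0; [exact: fnorm_ge0 | exact: addr_ge0].
rewrite (le_trans (enorm_le_fnorm U))//; apply: (@le_trans _ _ T5).
  have [UW US] := MK _ UM; rewrite !lerD//.
  exact: fnorm_entry_le.
by rewrite lerDr.
Qed.

End LevelSets.

(** * Convergence of the algorithm *)

Lemma exists_expr_lt {R : realType} (b e : R) : 0 < b < 1 -> 0 < e ->
  exists i, b ^+ i < e.
Proof.
move=> /andP[b0 b1] e0.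
have /cvgrPdist_lt/(_ _ e0)[N _ /(_ N (leqnn N))] : b ^+ i @[i --> \oo] --> 0.
  by apply: cvg_expr; rewrite gtr0_norm.
by rewrite /= sub0r normrN ger0_norm ?exprn_ge0 1?ltW// => ?; exists N.
Qed.

(* A small [delta k] makes [e k.+1] small outright, a large one lowers the
   bound on the whole window by a fixed amount. *)
Lemma nonmonotone_cvg {R : realType} (e delta : nat -> R) (M : nat) (c C : R) :
  0 < c -> 0 <= C -> (forall k, 0 <= delta k) ->
  (forall k b, (forall j, (k.+1 - M <= j <= k)%N -> e j <= b) ->
     e k.+1 <= b - c * delta k) ->
  (forall k, e k.+1 <= delta k + C * Num.sqrt (delta k)) ->
  (exists b, forall k, e k <= b) ->
  forall eps, 0 < eps -> exists N, forall k, (N <= k)%N -> e k <= eps.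
Proof.
move=> c0 C0 delta0 e_dec e_small [b0 e_le] eps eps0.
have C1 : 0 < C + 1 by rewrite ltr_wpDl.
(* [(C + 1) * q = eps / 2]; with [delta k < eta], each of the two terms of [e_small] is at most
   [eps / 2]. *)
pose q := eps / (2 * (C + 1)); have q0 : 0 < q by rewrite divr_gt0 ?mulr_gt0.
pose eta := Num.min (eps / 2) (q ^+ 2).
have eta0 : 0 < eta by rewrite lt_min divr_gt0 ?exprn_gt0.
have small k : delta k < eta -> e k.+1 <= eps.
  rewrite lt_min => /andP[d1 d2]; apply: (le_trans (e_small k)).
  have sq : Num.sqrt (delta k) <= q.
    by rewrite -[leRHS]ger0_norm ?(ltW q0)// -sqrtr_sqr ler_wsqrtr ?ltW.
  have : C * Num.sqrt (delta k) <= eps / 2.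
    apply: (@le_trans _ _ ((C + 1) * q)).
      by rewrite ler_pM ?sqrtr_ge0// lerDl.
    by rewrite /q invfM mulrCA mulrA mulrCA mulfK ?gt_eqF// mulrC.
  by move: d1; lra.
have iter i : exists N, forall k, (N <= k)%N ->
    e k <= Num.max eps (b0 - i%:R * (c * eta)).
  elim: i => [|i [N IH]].
    by exists 0%N => k _; rewrite mul0r subr0 le_max e_le orbT.
  (* For an index [k.+1] past [N + M], the window starting at [k.+1 - M] lies entirely at or after
     [N], where the previous bound holds. *)
  exists (N + M).+1 => -[//|k] Nk.
  have [|big_delta] := ltP (delta k) eta; first by rewrite le_max => /small ->.
  apply: (@le_trans _ _ (Num.max eps (b0 - i%:R * (c * eta)) - c * delta k)).
    apply: e_dec => j /andP[kj _]; apply: IH; apply: leq_trans kj.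
    by rewrite leq_subRL ?(leq_trans (leq_addl N M) (ltnW Nk))// addnC ltnW.
  have := ler_wpM2l (ltW c0) big_delta; have := mulr_gt0 c0 eta0.
  rewrite -natr1; case: (leP eps) => _; rewrite le_max => *; apply/orP;
    last first.
    by left; lra.
  by right; lra.
have [i Hi] : exists i : nat, b0 - i%:R * (c * eta) <= eps.
  exists (Num.bound `|(b0 - eps) / (c * eta)|).
  rewrite lerBlDl -lerBlDr -ler_pdivrMr ?mulr_gt0//.
  apply: le_trans (ler_norm _) _; apply: ltW; exact: archi_boundP.
have [N HN] := iter i; exists N => k /HN /le_trans; apply.
by rewrite ge_max lexx.
Qed.

(** * One iteration: direction, damping, line search and uniform constants *)

Section Step.
Context {R : realType} {m n : nat} (P : problem R m n) (a : params R).
Hypothesis mu_gt0 : 0 < mu P.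
Hypothesis rho_gt0 : 0 < rho P.
Hypothesis lambda_gt0 : 0 < lambda P.
Hypothesis C_sym : Cmat P \is symmetricmx.
Hypothesis A_sym : forall i, Amat P i \is symmetricmx.
Implicit Types U V D : triple R m n.

Local Notation g := (dual_obj P).
Local Notation G := (dual_grad P).

Lemma dual_gradE U : Fset P U -> gradient g U = G U.
Proof. by move=> [_ UN]; apply: dual_gradient => //; exact: ltW. Qed.

Lemma dual_concave U V : Fset P U -> Fset P V ->
  g V <= g U + dot (G U) (V - U).
Proof.
by move=> [_ UN] [_ VN]; apply: dual_supergradient => //; exact: ltW.
Qed.

Section ProjectionStep.
Variables (U : triple R m n) (t : R).
Hypothesis UF : Fset P U.
Local Notation D := (proj_step P t U).

Let proj_stepP :
  is_projection (Mset P) (U + t *: G U) (projection (Mset P) (U + t *: G U)).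
Proof.
apply: Mset_projection; [exact: ltW | exact: ltW |].
have [UM UN] := UF; apply: is_symD; first exact: Mset_sym UM.
by apply: is_symZ; exact: dual_grad_sym.
Qed.

Lemma proj_step_Mset : Mset P (U + D).
Proof. by rewrite addrC subrK dual_gradE//; case: proj_stepP. Qed.

Lemma proj_step_sym : Defs.is_sym D.
Proof.
have := proj_step_Mset; move: D => E UE_M.
have -> : E = (U + E) - U by rewrite addrAC subrr add0r.
by apply: is_symB; [exact: Mset_sym UE_M | exact: Mset_sym (proj1 UF)].
Qed.

(** [projection_vi] with all points taken relative to [U]. At [V = U] it yields [proj_step_descent];
    at other points it controls the linear term of concavity. *)
Lemma proj_step_vi V : Mset P V ->
  t * dot (G U) (V - U) <= t * dot (G U) D + dot D (V - U) - dot D D.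
Proof.
move=> VM; have := projection_vi (@Mset_convex _ _ _ P) proj_stepP VM.
have -> : projection (Mset P) (U + t *: G U) = U + D.
  by rewrite /proj_step dual_gradE// [RHS]addrC subrK.
move: D => E.
have -> : U + t *: G U - (U + E) = t *: G U - E.
  by rewrite opprD addrACA subrr add0r.
have -> : V - (U + E) = (V - U) - E by rewrite opprD addrA.
rewrite dotDl dotNl dotZl !(dotDr _ _ (G U)) !(dotDr _ _ E) !dotNr; lra.
Qed.

Lemma proj_step_descent : dot D D <= t * dot (G U) D.
Proof.
have [UM _] := UF; have := proj_step_vi UM.
by rewrite subrr !dot0r; lra.
Qed.

End ProjectionStep.

(** The stopping test uses step length 1 and the direction uses [t]. If the slope were at most 0,
    [proj_step_descent] would make the direction for [t] vanish; the variational inequality at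
    [U + proj_step P 1 U] would then make the slope for length 1 at most 0, and descent for length 1
    would stop the run. *)
Lemma not_stops_gt0 U t : Fset P U -> 0 < t -> eps a = 0 -> ~ stops P a U ->
  0 < dot (G U) (proj_step P t U).
Proof.
move=> UF t_gt0 eps0 not_stop; rewrite ltNge; apply/negP => d_le0.
apply: not_stop; rewrite /stops eps0 enorm_le0.
have := proj_step_descent 1 UF.
have := @proj_step_vi U t UF _ (proj_step_Mset 1 UF).
move: (proj_step P 1 U) => E.
have D0 : proj_step P t U = 0.
  apply/dot_eq0/le_anti; rewrite dot_ge0 andbT.
  by rewrite (le_trans (proj_step_descent t UF))// pmulr_rle0.
rewrite {}D0 dot0r !dot0l mulr0 !addr0 subr0 mul1r.
have -> : U + E - U = E by rewrite addrAC subrr add0r.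
rewrite pmulr_rle0// => GE0 EE; apply/eqP/dot_eq0/le_anti.
by rewrite dot_ge0 andbT (le_trans EE).
Qed.

(** With a zero projection step, the variational inequality makes the linear term of concavity at
    most 0 towards every [V]. *)
Lemma stops_optimal U V : Fset P U -> eps a = 0 -> stops P a U ->
  Fset P V -> g V <= g U.
Proof.
move=> UF eps0; rewrite /stops eps0 enorm_le0 => /eqP D0 VF.
rewrite (le_trans (dual_concave UF VF))// gerDl.
have := @proj_step_vi U 1 UF _ (proj1 VF).
by rewrite D0 dot0r !dot0l; lra.
Qed.

Lemma calB_bounded : exists2 K, 0 <= K &
  forall U, fnorm (calB P U) <= K * enorm U.
Proof.
exists (\sum_i fnorm (Amat P i) + 2).
  by rewrite addr_ge0// sumr_ge0// => i _; exact: fnorm_ge0.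
move=> U.
have U_le : [/\ fnorm U.1.1 <= enorm U, fnorm U.1.2 <= enorm U &
    fnorm U.2 <= enorm U].
  split; rewrite /fnorm ler_sqrt ?dot_ge0// /dot;
  have := frob_dot_ge0 U.1.1; have := frob_dot_ge0 U.1.2;
  have := frob_dot_ge0 U.2; lra.
have [y_le W_le S_le] := U_le.
rewrite /calB (le_trans (fnormD _ _))// mulrDl.
have := fnormD (- calAT P U.1.1) (2^-1 *: U.1.2).
rewrite fnormN fnormZ ger0_norm//.
suff : fnorm (calAT P U.1.1) <= (\sum_i fnorm (Amat P i)) * enorm U.
  by move: W_le S_le; have := fnorm_ge0 U.1.2; lra.
rewrite (le_trans (fnorm_sum _ _))// mulr_suml; apply: ler_sum => i _.
rewrite fnormZ mulrC ler_wpM2l ?fnorm_ge0//.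
by rewrite (le_trans (entry_le_fnorm _ _ _)).
Qed.

Lemma is_nu_exists U D : (0 < n)%N -> Nset P U -> Defs.is_sym D ->
  exists nu, is_nu P a U D nu.
Proof.
move=> n_gt0 [_ U_pd] D_sym; have [L UL] := posdef_cholesky U_pd.
have [t Ht] : exists t,
    is_min_eigenvalue (invmx L *m calB P D *m invmx (L^T)) t.
  apply: min_eigenvalue_exists => //.
  by rewrite !trmx_mul !trmx_inv trmxK (calB_tr A_sym)// mulmxA.
by exists (if 0 <= t then 1 else Num.min 1 (- tau a / t)), L, t.
Qed.

(** Conjugation by the Cholesky factor turns the least eigenvalue [t] into [t * Z <= calB P D] as
    quadratic forms, so a multiple [nu <= tau / - t] removes at most the fraction [tau] of [Z]. The
    lower bound on [nu] comes from [t >= - fnorm (calB P D) * T]. *)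
Lemma is_nuP U D nu (T : R) : 0 < tau a < 1 -> Nset P U -> Defs.is_sym D ->
  is_nu P a U D nu -> \tr (invmx (slack P U)) <= T ->
  [/\ 0 < nu <= 1, tau a / (fnorm (calB P D) * T + 1) <= nu &
   forall x : 'cV[R]_n, - tau a * frob_dot x (slack P U *m x) <=
     nu * frob_dot x (calB P D *m x)].
Proof.
move=> /andP[tau0 tau1] [_ Z_pd] D_sym [L [t [ZL tmin nuE]]] ZT.
change (posdefmx (slack P U)) in Z_pd; change (is_cholesky (slack P U) L) in ZL.
set Z := slack P U in ZT Z_pd ZL *; set B := calB P D in nuE tmin *.
have L_unit := cholesky_unitmx ZL; have [_ _ LE] := ZL.
have LT_unit : L^T \in unitmx by rewrite unitmx_tr.
have B_sym : B^T = B by exact: calB_tr.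
set S := invmx L *m B *m invmx L^T in tmin.
have S_sym : S^T = S by rewrite !trmx_mul !trmx_inv trmxK B_sym mulmxA.
have SE (w : 'cV[R]_n) : frob_dot (L^T *m w) (S *m (L^T *m w)) =
    frob_dot w (B *m w).
  rewrite frob_dot_mull trmxK !mulmxA /S -!mulmxA (mulmxA (invmx _) L^T).
  by rewrite mulVmx// mul1mx !mulmxA mulmxV// mul1mx.
have ZE (w : 'cV[R]_n) : frob_dot (L^T *m w) (L^T *m w) = frob_dot w (Z *m w).
  by rewrite frob_dot_mull trmxK mulmxA LE.
have Z_ge0 (w : 'cV[R]_n) : 0 <= frob_dot w (Z *m w).
  by rewrite -ZE frob_dot_ge0.
have t_le (w : 'cV[R]_n) : t * frob_dot w (Z *m w) <= frob_dot w (B *m w).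
  by rewrite -ZE -SE min_eigenvalue_le.
have T_ge0 : 0 <= T := le_trans (posdef_inv_trace_ge0 Z_pd) ZT.
set q := fnorm B * T.
have q_ge0 : 0 <= q by rewrite mulr_ge0 ?fnorm_ge0.
(* With an eigenvector written as [L^T w], [t] is the form of [B] at [w] over the form of [Z] at
   [w], and [posdef_lower] bounds [|w|^2] by [T] times the denominator. *)
have t_ge : - q <= t.
  have [x x0 xE] := eigenvalue_quad S_sym (proj1 tmin).
  have xx0 := frob_dot_gt0 x0.
  have -> : t = frob_dot x (S *m x) / frob_dot x x.
    by rewrite xE mulfK// gt_eqF.
  rewrite ler_pdivlMr//; pose w := invmx L^T *m x.
  have xw : x = L^T *m w by rewrite /w mulmxA mulmxV// mul1mx.
  rewrite xw SE ZE mulNr lerNl (le_trans (ler_norm _))// normrN.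
  rewrite (le_trans (frob_dot_le_fnorm _ _))//.
  rewrite (le_trans (ler_wpM2l (fnorm_ge0 _) (fnorm_mul_le _ _)))//.
  rewrite mulrCA -expr2 sqr_fnorm /q -mulrA ler_wpM2l ?fnorm_ge0//.
  by rewrite (le_trans (posdef_lower w Z_pd))// ler_wpM2r.
have q1 : 0 < q + 1 by rewrite ltr_wpDl.
rewrite nuE; have [t0|t0] := leP 0 t.
  split; first by rewrite ltr01 lexx.
    by rewrite ler_pdivrMr// mul1r; lra.
  move=> x; have := t_le x; have := mulr_ge0 t0 (Z_ge0 x).
  by have := mulr_ge0 (ltW tau0) (Z_ge0 x); lra.
have tauE : - tau a / t = tau a / - t by rewrite invrN mulrN mulNr.
have nt0 : 0 < - t by rewrite oppr_gt0.
split.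
- by rewrite tauE lt_min ltr01 divr_gt0//= ge_min lexx.
- rewrite le_min ler_pdivrMr// mul1r; apply/andP; split; first by lra.
  rewrite tauE ler_wpM2l ?(ltW tau0)// lef_pV2 ?posrE//; lra.
- move=> x; set r := Num.min _ _.
  have r0 : 0 <= r by rewrite /r tauE le_min ler01 divr_ge0// ltW.
  have r_le : r <= tau a / - t by rewrite /r tauE ge_min lexx orbT.
  have rt : - tau a <= r * t.
    by rewrite ler_pdivlMr// in r_le; lra.
  have := ler_wpM2l r0 (t_le x); have := ler_wpM2r (Z_ge0 x) rt.
  by rewrite mulrA; lra.
Qed.

Section DampedStep.
Variables (U D : triple R m n) (nu : R).
Hypothesis tau01 : 0 < tau a < 1.
Hypothesis UF : Fset P U.
Hypothesis D_sym : Defs.is_sym D.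
Hypothesis UD_M : Mset P (U + D).
Hypothesis nuP : is_nu P a U D nu.

Lemma damped_slack_ge r (x : 'cV[R]_n) : 0 <= r <= nu ->
  (1 - tau a) * frob_dot x (slack P U *m x) <=
    frob_dot x (slack P (U + r *: D) *m x).
Proof.
move=> /andP[r0 r_nu].
have [/andP[nu0 nu1] _ nu_ge] := is_nuP tau01 (proj2 UF) D_sym nuP (lexx _).
have := nu_ge x; set zx := frob_dot x (slack P U *m x); set bx := frob_dot _ _.
have zx0 : 0 <= zx.
  rewrite /zx; have [->|x0] := eqVneq x 0; first by rewrite frob_dot0l.
  exact/ltW/(posdef_gt0 (proj2 (proj2 UF))).
rewrite slack_line mulmxDl frob_dotDr -scalemxAl frob_dotZr -/zx -/bx.
move=> h; suff : - tau a * zx <= r * bx by lra.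
have := mulr_ge0 (ltW (proj1 (andP tau01))) zx0.
have [bx0|bx0] := leP 0 bx; first by have := mulr_ge0 r0 bx0; lra.
by have := ler_wnM2r (ltW bx0) r_nu; lra.
Qed.

Lemma damped_Fset r : 0 <= r <= nu -> Fset P (U + r *: D).
Proof.
move=> r_nu; have [/andP[nu0 nu1] _ _] :=
  is_nuP tau01 (proj2 UF) D_sym nuP (lexx _).
have [r0 r_le] := andP r_nu; have [UM [U_sym U_pd]] := UF; split.
  have := Mset_convex UM UD_M (t := r).
  by rewrite (addrC U D) addrK; apply; rewrite r0 (le_trans r_le).
have UrD_sym : Defs.is_sym (U + r *: D) by apply: is_symD => //; exact: is_symZ.
split=> //; apply: posdefP => [|x x0]; first exact: slack_tr.
apply: lt_le_trans (damped_slack_ge x r_nu).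
by rewrite mulr_gt0 ?(posdef_gt0 U_pd)// subr_gt0; case/andP: tau01.
Qed.

(** Concavity at the new point bounds [g U] by [g (U + r *: D)] minus [r] times the slope there;
    replacing this slope by the one at [U] costs the quadratic term. *)
Lemma damped_increase r T : 0 <= r <= nu -> \tr (invmx (slack P U)) <= T ->
  g U + r * dot (G U) D - r ^+ 2 * (mu P *
    (T * fnorm (calB P D) * (n%:R * T / (1 - tau a)) * fnorm (calB P D)))
  <= g (U + r *: D).
Proof.
move=> r_nu ZT; have [r0 r_le] := andP r_nu; have [tau0 tau1] := andP tau01.
have UrF := damped_Fset r_nu.
have [_ [_ Z_pd]] := UF; have [_ [_ Z'_pd]] := UrF.
have := dual_concave UrF UF.
have -> : U - (U + r *: D) = - (r *: D) by rewrite opprD addrA subrr add0r.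
rewrite dotNr dotZr !dual_grad_dot.
change (posdefmx (slack P U)) in Z_pd.
change (posdefmx (slack P (U + r *: D))) in Z'_pd.
have Z'E := slack_line P U D r.
have ge_Z (x : 'cV[R]_n) := damped_slack_ge x r_nu.
set Z := slack P U in Z_pd ZT Z'E ge_Z *.
set Z' := slack P (U + r *: D) in Z'_pd Z'E ge_Z *; set B := calB P D.
have T_ge0 : 0 <= T := le_trans (posdef_inv_trace_ge0 Z_pd) ZT.
have tau1' : 0 < 1 - tau a by rewrite subr_gt0.
have Z_unit := posdef_unitmx Z_pd; have Z'_unit := posdef_unitmx Z'_pd.
(* The resolvent identity for [Z' = Z + r *: B]. *)
have invE : invmx Z' = invmx Z - r *: (invmx Z *m B *m invmx Z').
  have -> : r *: (invmx Z *m B *m invmx Z') = invmx Z *m (Z' - Z) *m invmx Z'.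
    have -> : Z' - Z = r *: B by rewrite Z'E addrAC subrr add0r.
    by rewrite -scalemxAr -scalemxAl.
  rewrite mulmxBr mulVmx// mulmxBl mul1mx -mulmxA mulmxV// mulmx1.
  by rewrite opprB addrC subrK.
(* For [M = L^-T], with [L] the factor of [Z'], the form of [Z'] at [M] is the trace of the
   identity, which explains the factor [n]. [damped_slack_ge], applied column by column, carries the
   bound over to the form of [Z]. *)
have trZ' : \tr (invmx Z') <= n%:R * T / (1 - tau a).
  have [L Z'L] := posdef_cholesky Z'_pd; have [_ _ LE] := Z'L.
  have L_unit := cholesky_unitmx Z'L.
  pose M := (invmx L)^T; have trE : \tr (invmx Z') = frob_dot M M.
    by rewrite frob_dot_tr (invmx_trace Z'L).
  have MZ' : frob_dot M (Z' *m M) = n%:R.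
    rewrite -LE frob_dotC frob_dotE !trmx_mul trmxK /M trmxK !mulmxA.
    rewrite mulVmx// mul1mx trmx_inv.
    by rewrite mulmxV ?unitmx_tr// mxtrace1.
  have MZ : (1 - tau a) * frob_dot M (Z *m M) <= n%:R.
    have colE (X : 'M[R]_n) : frob_dot M (X *m M) =
        \sum_j frob_dot (col j M) (X *m col j M).
      rewrite /frob_dot exchange_big/=; apply: eq_bigr => j _.
      apply: eq_bigr => i _; rewrite zmodp.big_ord1 [col j M i 0]mxE.
      rewrite ![(X *m _) _ _]mxE; congr (_ * _).
      by apply: eq_bigr => k _; rewrite [col j M k _]mxE.
    by rewrite -MZ' !colE mulr_sumr ler_sum.
  rewrite trE ler_pdivlMr// mulrC.
  have := posdef_lower M Z_pd; have := posdef_inv_trace_ge0 Z_pd.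
  have := frob_dot_ge0 M; have : 0 <= frob_dot M (Z *m M).
    have [K [_ _ <-]] := posdef_cholesky Z_pd.
    by rewrite -mulmxA -[K in K *m _]trmxK -frob_dot_mull frob_dot_ge0.
  move=> MZ0 _ tr0 low.
  apply: (@le_trans _ _ ((1 - tau a) * (T * frob_dot M (Z *m M)))).
    rewrite ler_pM2l// (le_trans low)// ler_wpM2r//.
  by rewrite mulrCA mulrC ler_wpM2r.
have fB0 := fnorm_ge0 B.
have cross : `|frob_dot (invmx Z *m B *m invmx Z') B| <=
    T * fnorm B * (n%:R * T / (1 - tau a)) * fnorm B.
  rewrite (le_trans (frob_dot_le_fnorm _ _))// ler_wpM2r//.
  rewrite (le_trans (fnorm_mul_le _ _))// ler_pM ?fnorm_ge0//.
    rewrite (le_trans (fnorm_mul_le _ _))// ler_wpM2r//.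
    by rewrite (le_trans (posdef_inv_fnorm Z_pd)).
  by rewrite (le_trans (posdef_inv_fnorm Z'_pd)).
have E : frob_dot (invmx Z') B =
    frob_dot (invmx Z) B - r * frob_dot (invmx Z *m B *m invmx Z') B.
  by rewrite {1}invE frob_dotDl frob_dotNl frob_dotZl.
move: cross E; set c := frob_dot (_ *m _) B; set K := _ * fnorm B.
move=> cK ->; have {cK} : c <= K := le_trans (ler_norm c) cK.
have r2mu : 0 <= r ^+ 2 * mu P by rewrite mulr_ge0 ?sqr_ge0// ltW.
move=> /(ler_wpM2l r2mu) cK.
rewrite !mulrDr !mulrN; rewrite -/B.
have -> : r * (mu P * (r * c)) = r ^+ 2 * mu P * c by ring.
have -> : r ^+ 2 * (mu P * K) = r ^+ 2 * mu P * K by ring.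
lra.
Qed.

End DampedStep.

Lemma reference_value_le (u : nat -> triple R m n) k :
  reference_value P a u k <= g (u k).
Proof.
rewrite /reference_value.
by elim/big_rec: _ => [//|j x _ x_le]; rewrite ge_min x_le orbT.
Qed.

Lemma reference_value_ge (u : nat -> triple R m n) k b : (0 < memory a)%N ->
  (forall j, (k.+1 - memory a <= j <= k)%N -> b <= g (u j)) ->
  b <= reference_value P a u k.
Proof.
move=> M_gt0 b_le; rewrite /reference_value big_seq.
elim/big_ind: _ => [|x y bx by_|j].
- by apply: b_le; rewrite leqnn leq_subLR -{1}[k.+1]add1n leq_add.
- by rewrite le_min bx.
- by rewrite mem_index_iota ltnS; exact: b_le.
Qed.

Section LineSearch.
Variables (u : nat -> triple R m n) (k : nat) (t nu : R).
Hypothesis a_adm : admissible a.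
Hypothesis eps0 : eps a = 0.
Hypothesis uF : Fset P (u k).
Hypothesis t_gt0 : 0 < t.
Hypothesis go_on : ~ stops P a (u k).
Local Notation D := (proj_step P t (u k)).
Hypothesis nuP : is_nu P a (u k) D nu.

Let tau01 : 0 < tau a < 1. Proof. by case: a_adm => [[]]. Qed.
Let gamma01 : 0 < gamma a < 1. Proof. by case: a_adm => [[]]. Qed.
Let beta01 : 0 < beta a < 1. Proof. by case: a_adm => [[]]. Qed.

(** The coefficient of [r ^+ 2] in [damped_increase]. *)
Let curvature (T : R) : R :=
  mu P * (T * fnorm (calB P D) * (n%:R * T / (1 - tau a)) * fnorm (calB P D)).

Let curvature_ge0 T : 0 <= T -> 0 <= curvature T.
Proof.
move=> T0; have fB0 := fnorm_ge0 (calB P D).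
have tau1' : 0 <= (1 - tau a)^-1.
  by rewrite invr_ge0 subr_ge0 ltW//; case/andP: tau01.
by rewrite /curvature !mulr_ge0// ltW.
Qed.

Let nu01 : 0 < nu <= 1.
Proof.
by have [] := is_nuP tau01 (proj2 uF) (proj_step_sym t uF) nuP (lexx _).
Qed.

(** For [r = s * nu] the model gains at least [r * d - r ^+ 2 * curvature T], which is
    [gamma * r * d] or more under the hypothesis; the reference value is at most [g (u k)]. *)
Let accept_of_small T s : \tr (invmx (slack P (u k))) <= T -> 0 <= s <= 1 ->
  s * nu * curvature T <= (1 - gamma a) * dot (G (u k)) D ->
  accepted P a u k D nu s.
Proof.
move=> ZT /andP[s0 s1] small; have [nu0 nu1] := andP nu01.
have r_nu : 0 <= s * nu <= nu.
  by rewrite mulr_ge0 ?(ltW nu0)//= ler_piMl// ltW.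
rewrite /accepted dual_gradE//.
have := damped_increase tau01 uF (proj_step_sym t uF) (proj_step_Mset t uF)
  nuP r_nu ZT.
rewrite -/(curvature T); have [r0 _] := andP r_nu.
have := reference_value_le u k; have := ler_wpM2l r0 small.
set d := dot _ _; set r := s * nu; set K := curvature T => h1 h2.
apply: le_trans; rewrite -/r in h1.
have -> : gamma a * s * nu * d = gamma a * r * d by rewrite /r; ring.
have -> : r ^+ 2 * K = r * (r * K) by ring.
have E : r * ((1 - gamma a) * d) = r * d - gamma a * r * d by ring.
rewrite E in h1.
lra.
Qed.

(** The slope is positive, so high powers of [beta] satisfy [accept_of_small]; the least accepted
    exponent gives the largest accepted power. *)
Lemma line_search_exists : exists s, is_sigma P a u k D nu s.
Proof.
have d0 := not_stops_gt0 uF t_gt0 eps0 go_on.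
have [nu0 nu1] := andP nu01; have [b0 b1] := andP beta01.
have [g0 g1] := andP gamma01.
pose T := \tr (invmx (slack P (u k))).
have T0 : 0 <= T by exact: posdef_inv_trace_ge0 (proj2 (proj2 uF)).
have K0 := curvature_ge0 T0.
have K1 : 0 < curvature T + 1 by rewrite ltr_wpDl.
have e0 : 0 < (1 - gamma a) * dot (G (u k)) D / (curvature T + 1).
  by rewrite divr_gt0// mulr_gt0// subr_gt0.
have [i i_small] := exists_expr_lt beta01 e0.
have i_acc : accepted P a u k D nu (beta a ^+ i).
  apply: (accept_of_small (lexx T)).
    by rewrite exprn_ge0 ?exprn_ile1// ltW.
  have bi0 : 0 <= beta a ^+ i by rewrite exprn_ge0// ltW.
  have := ltW i_small; rewrite ler_pdivlMr//; apply: le_trans.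
  rewrite -mulrA ler_wpM2l// (le_trans (ler_piMl K0 nu1))//.
  by rewrite lerDl.
pose Q j := `[< accepted P a u k D nu (beta a ^+ j) >].
have exQ : exists j, Q j by exists i; apply/asboolP.
case: (ex_minnP exQ) => j /asboolP j_acc j_min.
exists (beta a ^+ j); split => //; first by exists j.
move=> l l_acc; apply: ler_wiXn2l; [exact: ltW | exact: ltW |].
by apply: j_min; apply/asboolP.
Qed.

(** After a backtrack, the preceding trial [s / beta] was rejected, so it violates the condition of
    [accept_of_small]; this is where the factor [beta] arises. *)
Lemma sigma_bounds s T : is_sigma P a u k D nu s ->
  \tr (invmx (slack P (u k))) <= T ->
  0 < s <= 1 /\ (s = 1 \/
    beta a * (1 - gamma a) * dot (G (u k)) D <= s * nu * curvature T).
Proof.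
have [nu0 nu1] := andP nu01; have [b0 b1] := andP beta01.
move=> [[i ->] _ s_max] ZT.
split; first by rewrite exprn_gt0// exprn_ile1// ltW.
case: i s_max => [|i] s_max; first by left; rewrite expr0.
right; rewrite leNgt; apply/negP => lt_d.
have : accepted P a u k D nu (beta a ^+ i).
  apply: (accept_of_small ZT); first by rewrite exprn_ge0 ?exprn_ile1// ltW.
  apply: ltW; rewrite -(ltr_pM2l b0); move: lt_d.
  by rewrite exprS !mulrA.
move=> /s_max; rewrite exprS; apply/negP; rewrite -ltNge.
by rewrite gtr_pMl// exprn_gt0.
Qed.

End LineSearch.

(** The constants depend on the level [c0] alone. The sequence [u] is quantified inside because
    acceptance looks at past iterates, while the bounds see only the current point. *)
Lemma uniform_bounds (c0 : R) : admissible a -> eps a = 0 ->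
  A_surjective P -> primal_slater P ->
  exists2 c, 0 < c & exists2 C, 0 <= C &
  forall U t, Fset P U -> c0 <= g U -> alpha_min a <= t <= alpha_max a ->
    ~ stops P a U ->
    let D := proj_step P t U in let d := dot (G U) D in
    (forall u k nu s, u k = U -> is_nu P a U D nu ->
       is_sigma P a u k D nu s -> c <= s * nu) /\
    (forall r V, 0 <= r <= 1 -> Fset P (U + r *: D) -> c0 <= g (U + r *: D) ->
       Fset P V -> c0 <= g V -> g V - g (U + r *: D) <= d + C * Num.sqrt d).
Proof.
move=> a_adm eps0 A_surj slater.
have [[_ tau01 gamma01 beta01] [amin0 amin_max _]] := a_adm.
have [tau0 tau1] := andP tau01; have [gamma0 gamma1] := andP gamma01.
have [beta0 beta1] := andP beta01.
have [T T0 level] := level_set_bounded c0 mu_gt0 (ltW rho_gt0)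
  (ltW lambda_gt0) A_surj slater.
have [KB KB0 calB_le] := calB_bounded.
have amax0 : 0 < alpha_max a := lt_trans amin0 amin_max.
(* Bounds the gradient on the superlevel set; [Dm] below follows from [|D|^2 <= alpha_max * d <=
   alpha_max * Gm * |D|]. *)
pose Gm := fnorm (bvec P) + mu P * (T * KB).
have Gm0 : 0 <= Gm by rewrite addr_ge0 ?fnorm_ge0// !mulr_ge0// ltW.
have G_le U V : Fset P U -> c0 <= g U -> dot (G U) V <= Gm * enorm V.
  move=> [UM UN] gU; have [ZT _] := level U UM UN gU.
  rewrite dual_grad_dot mulrDl; apply: lerD.
    rewrite (le_trans (ler_norm _))// (le_trans (frob_dot_le_fnorm _ _))//.
    rewrite ler_wpM2l ?fnorm_ge0// /fnorm /enorm ler_sqrt ?dot_ge0// /dot.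
    by rewrite -addrA lerDl addr_ge0 ?frob_dot_ge0.
  rewrite -mulrA ler_wpM2l ?(ltW mu_gt0)// (le_trans (ler_norm _))//.
  rewrite (le_trans (frob_dot_le_fnorm _ _))// -mulrA ler_pM ?fnorm_ge0//.
  exact: le_trans (posdef_inv_fnorm (proj2 UN)) ZT.
pose Dm := alpha_max a * Gm; have Dm0 : 0 <= Dm by rewrite mulr_ge0// ltW.
pose nu0 := tau a / (KB * Dm * T + 1).
have q0 : 0 <= KB * Dm * T by rewrite mulr_ge0 ?(mulr_ge0 KB0 Dm0).
have nu0_gt0 : 0 < nu0 by rewrite divr_gt0// ltr_wpDl.
pose K3 := mu P * (T * KB * (n%:R * T / (1 - tau a)) * KB).
have tau1' : 0 <= (1 - tau a)^-1 by rewrite invr_ge0 subr_ge0 ltW.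
have K30 : 0 <= K3 by rewrite /K3 !mulr_ge0// ltW.
have K31 : 0 < K3 * alpha_max a + 1 by rewrite ltr_wpDl// mulr_ge0// ltW.
(* The curvature is at most [K3 * dot D D <= K3 * alpha_max * d], so [d] cancels on both sides of
   the second alternative of [sigma_bounds]. *)
pose s0 := beta a * (1 - gamma a) / (K3 * alpha_max a + 1).
have s0_gt0 : 0 < s0 by rewrite divr_gt0// mulr_gt0// subr_gt0.
exists (Num.min nu0 s0); first by rewrite lt_min nu0_gt0.
(* The first term serves the passage from [U] to [V], with [|V - U| <= 2 * T] and [t >= alpha_min];
   [Gm] serves the passage from [U + r *: D] back to [U]. *)
pose C1 := 2 * T / alpha_min a + Gm.
have C10 : 0 <= C1 by rewrite addr_ge0// divr_ge0 ?mulr_ge0// ltW.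
exists (C1 * Num.sqrt (alpha_max a)); first by rewrite mulr_ge0 ?sqrtr_ge0.
move=> U t UF gU /andP[t_min t_max] go_on D d.
have t0 : 0 < t := lt_le_trans amin0 t_min.
have d0 : 0 < d := not_stops_gt0 UF t0 eps0 go_on.
have [ZT UT] := level U (proj1 UF) (proj2 UF) gU.
have DD : dot D D <= alpha_max a * d.
  by rewrite (le_trans (proj_step_descent t UF))// ler_wpM2r// ltW.
have D_sqrt : enorm D <= Num.sqrt (alpha_max a) * Num.sqrt d.
  by rewrite -sqrtrM ?(ltW amax0)// /enorm ler_wsqrtr.
have D_le : enorm D <= Dm.
  have [D0|D0] := leP (enorm D) 0; first exact: le_trans D0 Dm0.
  rewrite -(ler_pM2r D0) -expr2 sqr_enorm (le_trans DD)// /Dm -mulrA.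
  by rewrite ler_wpM2l ?(ltW amax0)// G_le.
have D_sym : Defs.is_sym D := proj_step_sym t UF.
have vi := @proj_step_vi U t UF.
have sb u k nu s : u k = U -> is_nu P a U D nu -> is_sigma P a u k D nu s ->
    0 < s <= 1 /\ (s = 1 \/ beta a * (1 - gamma a) * d <= s * nu *
      (mu P * (T * fnorm (calB P D) * (n%:R * T / (1 - tau a)) *
        fnorm (calB P D)))).
  move=> uk nuP sP; rewrite -uk in UF ZT; rewrite /d /D -uk in nuP sP *.
  exact: (sigma_bounds a_adm UF nuP sP ZT).
rewrite -/D -/d in vi; clearbody D.
split=> [u k nu s uk nuP sP|r V /andP[r0 r1] U'F gU' VF gV].
  have [/andP[nu_gt0 _] nu_ge _] := is_nuP tau01 (proj2 UF) D_sym nuP ZT.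
  have nu0_le : nu0 <= nu.
    apply: le_trans nu_ge; rewrite ler_wpM2l ?(ltW tau0)//.
    have B1 : fnorm (calB P D) * T + 1 <= KB * Dm * T + 1.
      by rewrite lerD2r ler_wpM2r// (le_trans (calB_le D))// ler_wpM2l.
    have B0 : 0 < fnorm (calB P D) * T + 1.
      by rewrite ltr_wpDl// mulr_ge0// fnorm_ge0.
    by rewrite lef_pV2// posrE ltr_wpDl.
  have [/andP[s_gt0 s_le1] s_ge] := sb u k nu s uk nuP sP.
  rewrite ge_min; case: s_ge => [->|s_ge]; first by rewrite mul1r nu0_le.
  apply/orP; right; rewrite ler_pdivrMr//.
  have r0 : 0 <= s * nu by rewrite mulr_ge0// ltW.
  rewrite -(ler_pM2r d0); apply: (le_trans s_ge).
  rewrite -[leRHS]mulrA ler_wpM2l// mulrDl mul1r.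
  have BB : fnorm (calB P D) * fnorm (calB P D) <=
      KB * KB * (alpha_max a * d).
    have := calB_le D; have := fnorm_ge0 (calB P D) => B0 BD.
    apply: (@le_trans _ _ ((KB * enorm D) * (KB * enorm D))).
      by rewrite ler_pM.
    by rewrite mulrACA -(expr2 (enorm D)) sqr_enorm ler_wpM2l// mulr_ge0.
  have K4 : 0 <= mu P * (T * (n%:R * T / (1 - tau a))).
    by rewrite !mulr_ge0// ltW.
  have := ler_wpM2l K4 BB; have := ltW d0; rewrite /K3.
  move: (fnorm _) (n%:R * T / _) => x y.
  set lhs := (X in _ -> X <= _ -> _); set rhs := (X in _ -> _ <= X -> _).
  have -> : lhs = mu P * (T * x * y * x) by rewrite /lhs; ring.
  have -> : rhs = mu P * (T * KB * y * KB) * alpha_max a * d.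
    by rewrite /rhs; ring.
  lra.
have [_ VT] := level V (proj1 VF) (proj2 VF) gV.
have gVU : g V - g U <= d + enorm D * (2 * T / alpha_min a).
  have := dual_concave UF VF; have := vi V (proj1 VF); have := dot_ge0 D.
  have : dot D (V - U) <= enorm D * (2 * T).
    rewrite (le_trans (dot_le_enorm _ _))// ler_wpM2l ?enorm_ge0//.
    by rewrite (le_trans (enormD _ _))// enormN; lra.
  move=> h1 h2 h3 h4; have h5 : dot (G U) (V - U) <= d + enorm D * (2 * T) / t.
    rewrite -lerBlDl ler_pdivlMr// mulrBl; lra.
  have : enorm D * (2 * T) / t <= enorm D * (2 * T / alpha_min a).
    rewrite -!mulrA !ler_wpM2l ?enorm_ge0 ?mulr_ge0// lef_pV2 ?posrE//.
  by move: h4 h5; lra.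
have gUU' : g U - g (U + r *: D) <= enorm D * Gm.
  have := dual_concave U'F UF.
  have -> : U - (U + r *: D) = - (r *: D) by rewrite opprD addrA subrr add0r.
  have := G_le _ (- (r *: D)) U'F gU'; rewrite enormN enormZ ger0_norm//.
  have : r * enorm D * Gm <= enorm D * Gm.
    by rewrite ler_wpM2r// ler_piMl ?enorm_ge0.
  by rewrite (mulrC Gm); lra.
have : enorm D * C1 <= C1 * Num.sqrt (alpha_max a) * Num.sqrt d.
  by rewrite mulrC -mulrA ler_wpM2l.
by rewrite /C1 mulrDr; lra.
Qed.

Lemma next_alpha_range U V : admissible a ->
  alpha_min a <= next_alpha P a U V <= alpha_max a.
Proof.
move=> [_ [_ /ltW amin_max _]]; rewrite /next_alpha /=.
case: ifP => _; first by rewrite amin_max lexx.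
by rewrite le_min amin_max le_max !lexx ge_min lexx.
Qed.

(** For [n = 0] no eigenvalue exists and [nu] would be undefined. Surjectivity then forces [m = 0],
    so the only triple is 0 and the run stops before [nu] is needed. *)
Lemma dim0_stops U : n = 0%N -> A_surjective P -> eps a = 0 -> stops P a U.
Proof.
move=> n0 A_surj eps0; rewrite /stops eps0 enorm_le0; apply/eqP.
have n_empty (i : 'I_n) : False by case: i; rewrite n0.
have m_empty (i : 'I_m) : False.
  have [X _ /matrixP/(_ i 0)/eqP] := A_surj (const_mx 1).
  rewrite !mxE /frob_dot big1; first by rewrite eq_sym oner_eq0.
  by move=> j; case: (n_empty j).
case: (proj_step _ _ _) => -[y W] S; congr (_, _, _); apply/matrixP => i.
- by case: (m_empty i).
- by case: (n_empty i).
- by case: (n_empty i).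
Qed.

Lemma iteration_data_exists (u : nat -> triple R m n) k t : admissible a ->
  eps a = 0 -> A_surjective P -> Fset P (u k) ->
  alpha_min a <= t <= alpha_max a -> ~ stops P a (u k) ->
  exists nu s, is_nu P a (u k) (proj_step P t (u k)) nu /\
    is_sigma P a u k (proj_step P t (u k)) nu s.
Proof.
move=> a_adm eps0 A_surj UF /andP[t_min _] go_on.
have [_ [amin0 _ _]] := a_adm; have t0 := lt_le_trans amin0 t_min.
have n_gt0 : (0 < n)%N.
  by rewrite lt0n; apply/eqP => n0; exact: go_on (dim0_stops _ n0 A_surj eps0).
have [nu nuP] := is_nu_exists n_gt0 (proj2 UF) (proj_step_sym t UF).
have [s sP] := line_search_exists a_adm eps0 UF t0 go_on nuP.
by exists nu, s.
Qed.

Lemma iteration_invariant u alpha k : admissible a -> eps a = 0 ->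
  Fset P (u k) -> alpha_min a <= alpha k <= alpha_max a ->
  ~ stops P a (u k) -> iteration P a u alpha k ->
  [/\ Fset P (u k.+1), alpha_min a <= alpha k.+1 <= alpha_max a &
   exists nu s, [/\ is_nu P a (u k) (proj_step P (alpha k) (u k)) nu,
     is_sigma P a u k (proj_step P (alpha k) (u k)) nu s, 0 <= s * nu <= 1 &
     u k.+1 = u k + (s * nu) *: proj_step P (alpha k) (u k)]].
Proof.
move=> a_adm eps0 UF alpha_k go_on [nu [s [nuP sP uE alphaE]]].
have [[_ tau01 _ _] _] := a_adm.
have [/andP[nu0 nu1] _ _] :=
  is_nuP tau01 (proj2 UF) (proj_step_sym (alpha k) UF) nuP (lexx _).
have [/andP[s0 s1] _] := sigma_bounds a_adm UF nuP sP (lexx _).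
have r_nu : 0 <= s * nu <= nu.
  by rewrite mulr_ge0 ?(ltW nu0) ?(ltW s0)//= ler_piMl// ltW.
split; last 1 first.
- exists nu, s; split=> //.
  by have [-> r_le] := andP r_nu; rewrite (le_trans r_le).
- rewrite uE; apply: (damped_Fset tau01 UF _ _ nuP r_nu).
    exact: proj_step_sym.
  exact: proj_step_Mset.
- by rewrite alphaE next_alpha_range.
Qed.

End Step.

Lemma iteration_eq {R : realType} {m n : nat} (P : problem R m n)
    (a : params R) u u' alpha alpha' k :
  (forall j, (j <= k.+1)%N -> u j = u' j /\ alpha j = alpha' j) ->
  iteration P a u alpha k -> iteration P a u' alpha' k.
Proof.
move=> E; have [uk ak] := E _ (leqnSn k); have [uk1 ak1] := E _ (leqnn k.+1).
have refE : reference_value P a u k = reference_value P a u' k.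
  rewrite /reference_value uk; apply: eq_big_nat => j /andP[_ jk].
  by have [->] := E j (ltnW jk).
rewrite /iteration /is_sigma /accepted refE uk ak uk1 ak1.
by [].
Qed.

(** The reference value reads past iterates, so the recursion runs on whole sequences: stage [k]
    keeps the entries up to [k] and overwrites the later ones. The run is the diagonal of these
    stages. *)
Lemma execution_exists {R : realType} {m n : nat} (P : problem R m n)
    (a : params R) (U0 : triple R m n) (alpha0 : R) :
  0 < mu P -> 0 < rho P -> 0 < lambda P ->
  Cmat P \is symmetricmx -> (forall i, Amat P i \is symmetricmx) ->
  A_surjective P -> admissible a -> eps a = 0 -> Fset P U0 ->
  alpha_min a <= alpha0 <= alpha_max a ->
  exists u alpha, execution P a U0 alpha0 u alpha.
Proof.
move=> mu0 rho0 lambda0 C_sym A_sym A_surj a_adm eps0 U0F alpha0_range.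
pose state := ((nat -> triple R m n) * (nat -> R))%type.
pose good (st : state) k := [/\ Fset P (st.1 k),
  alpha_min a <= st.2 k <= alpha_max a & ~ stops P a (st.1 k)].
have step k (st : state) : exists st' : state,
    (forall j, (j <= k)%N -> st'.1 j = st.1 j /\ st'.2 j = st.2 j) /\
    (good st k -> iteration P a st'.1 st'.2 k).
  (* A state that is not [good] is left unchanged; for such a state the claim about [iteration] is
     vacuous. *)
  have [[UF t_range go_on]|] := pselect (good st k); last by exists st.
  have [nu [s [nuP sP]]] := iteration_data_exists mu0 rho0 lambda0 C_sym A_sym
    a_adm eps0 A_surj UF t_range go_on.
  pose x := st.1 k + (s * nu) *: proj_step P (st.2 k) (st.1 k).
  pose y := next_alpha P a (st.1 k) x.
  pose u' j := if (j <= k)%N then st.1 j else x.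
  pose alpha' j := if (j <= k)%N then st.2 j else y.
  exists (u', alpha'); split=> [j jk|_]; first by rewrite /u' /alpha' /= jk.
  have u'k : u' k = st.1 k by rewrite /u' leqnn.
  have refE : reference_value P a u' k = reference_value P a st.1 k.
    rewrite /reference_value u'k; apply: eq_big_nat => j /andP[_ jk].
    by rewrite /u' -ltnS jk.
  exists nu, s; rewrite /is_sigma /accepted refE /= u'k.
  by rewrite /u' /alpha' leqnn ltnn; split.
have /choice[next nextP] : forall k, exists f : state -> state, forall st,
    (forall j, (j <= k)%N -> (f st).1 j = st.1 j /\ (f st).2 j = st.2 j) /\
    (good st k -> iteration P a (f st).1 (f st).2 k).
  by move=> k; have [f fP] := choice (step k); exists f.
pose fix S k : state :=
  if k is l.+1 then next l (S l) else (fun=> U0, fun=> alpha0).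
have S_stable k j : (j <= k)%N ->
    (S k).1 j = (S j).1 j /\ (S k).2 j = (S j).2 j.
  elim: k => [|k IHk]; first by rewrite leqn0 => /eqP ->.
  rewrite leq_eqVlt => /orP[/eqP -> //|jk].
  by have [-> ->] := (nextP k (S k)).1 j jk; exact: IHk.
pose u k := (S k).1 k; pose alpha k := (S k).2 k.
have iterE k : good (S k) k -> iteration P a u alpha k.
  move=> /(nextP k (S k)).2; apply: iteration_eq => j jk.
  exact: (S_stable k.+1 j jk).
have inv k : (forall j, (j < k)%N -> ~ stops P a (u j)) ->
    Fset P (u k) /\ alpha_min a <= alpha k <= alpha_max a.
  elim: k => [//|k IHk] go_on.
  have [UF alpha_k] : Fset P (u k) /\ alpha_min a <= alpha k <= alpha_max a.
    by apply: IHk => j jk; apply: go_on; exact: ltnW.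
  have go_k := go_on k (ltnSn k).
  by have [] := iteration_invariant mu0 rho0 lambda0 C_sym A_sym a_adm eps0 UF
    alpha_k go_k (iterE k (And3 UF alpha_k go_k)).
exists u, alpha; split=> // k go_on; apply: iterE.
by have [] := inv k (fun j jk => go_on j (ltnW jk)); split => //; exact: go_on.
Qed.

(** * Convergence of an execution *)

Section Convergence.
Context {R : realType} {m n : nat} (P : problem R m n) (a : params R).
Hypothesis mu_gt0 : 0 < mu P.
Hypothesis rho_gt0 : 0 < rho P.
Hypothesis lambda_gt0 : 0 < lambda P.
Hypothesis C_sym : Cmat P \is symmetricmx.
Hypothesis A_sym : forall i, Amat P i \is symmetricmx.
Hypothesis A_surj : A_surjective P.
Hypothesis slater : primal_slater P.
Hypothesis a_adm : admissible a.
Hypothesis eps0 : eps a = 0.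
Variables (U0 : triple R m n) (alpha0 : R).
Hypothesis U0F : Fset P U0.
Hypothesis alpha0_range : alpha_min a <= alpha0 <= alpha_max a.
Variables (u : nat -> triple R m n) (alpha : nat -> R).
Hypothesis u_exec : execution P a U0 alpha0 u alpha.

Local Notation g := (dual_obj P).

(** Strong induction: a nonmonotone step may decrease [g], but it stays above the window minimum,
    all of whose terms are at least [g U0]. *)
Lemma execution_invariant k : (forall j, (j < k)%N -> ~ stops P a (u j)) ->
  [/\ Fset P (u k), alpha_min a <= alpha k <= alpha_max a & g U0 <= g (u k)].
Proof.
have [u0 alpha_0 iter] := u_exec; have [_ [_ _ M_gt0]] := a_adm.
elim/ltn_ind: k => -[|k] IHk go_on; first by rewrite u0 alpha_0.
have IH j : (j <= k)%N -> [/\ Fset P (u j),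
    alpha_min a <= alpha j <= alpha_max a & g U0 <= g (u j)].
  move=> jk; apply: IHk => // l lj; apply: go_on.
  exact: leq_trans lj (leqW jk).
have [UF alpha_k _] := IH k (leqnn k); have go_k := go_on k (ltnSn k).
have [] := iteration_invariant mu_gt0 rho_gt0 lambda_gt0 C_sym A_sym a_adm eps0
  UF alpha_k go_k (iter k (fun j => go_on j)).
move=> UF' alpha_k' [nu [s [nuP sP /andP[r0 r1] uE]]]; split=> //.
have [_ + _] := sP; rewrite /accepted -uE; apply: le_trans.
rewrite dual_gradE//.
have [_ [amin0 _ _]] := a_adm.
have t0 := lt_le_trans amin0 (proj1 (andP alpha_k)).
have d0 := not_stops_gt0 mu_gt0 rho_gt0 lambda_gt0 C_sym A_sym UF t0 eps0 go_k.
have [[_ _ /andP[gamma0 _] _] _] := a_adm.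
apply: (@le_trans _ _ (reference_value P a u k)).
  by apply: reference_value_ge => // j /andP[_ jk]; have [] := IH j jk.
rewrite lerDl -(mulrA (gamma a)).
exact: mulr_ge0 (mulr_ge0 (ltW gamma0) r0) (ltW d0).
Qed.

(** The hypothesis on [gs] expresses the supremum through upper bounds over the superlevel set of
    [U0] only, the set on which [uniform_bounds] applies. *)
Lemma execution_gap (gs : R) : (forall k, ~ stops P a (u k)) ->
  (forall b, g U0 <= b -> (forall V, Fset P V -> g U0 <= g V -> g V <= b) ->
     gs <= b) ->
  forall e, 0 < e -> exists N, forall k, (N <= k)%N -> gs - g (u k) <= e.
Proof.
move=> go_on gs_le; have [u0 alpha_0 iter] := u_exec.
have inv k := execution_invariant (k := k) (fun j _ => go_on j).
have [[_ _ /andP[gamma0 _] _] [amin0 _ M_gt0]] := a_adm.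
have [c c0 [C C0 bounds]] := uniform_bounds mu_gt0 rho_gt0 lambda_gt0 C_sym
  A_sym (g U0) a_adm eps0 A_surj slater.
pose d k := dot (dual_grad P (u k)) (proj_step P (alpha k) (u k)).
have d_gt0 k : 0 < d k.
  have [UF /andP[alpha_k _] _] := inv k.
  apply: (not_stops_gt0 mu_gt0 rho_gt0 lambda_gt0 C_sym A_sym UF _ eps0
    (go_on k)).
  exact: lt_le_trans amin0 alpha_k.
have step k : exists nu s,
    [/\ is_nu P a (u k) (proj_step P (alpha k) (u k)) nu,
        is_sigma P a u k (proj_step P (alpha k) (u k)) nu s, 0 <= s * nu <= 1 &
        u k.+1 = u k + (s * nu) *: proj_step P (alpha k) (u k)].
  have [UF alpha_k _] := inv k.
  by have [] := iteration_invariant mu_gt0 rho_gt0 lambda_gt0 C_sym A_sym a_adm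
    eps0 UF alpha_k (go_on k) (iter k (fun j _ => go_on j)).
apply: (@nonmonotone_cvg _ (fun k => gs - g (u k)) d (memory a)
  (gamma a * c) C) => //.
- exact: mulr_gt0.
- by move=> k; exact: ltW.
- move=> k b b_le; have [nu [s [nuP sP _ uE]]] := step k.
  have [UF alpha_k gU] := inv k.
  have [/(_ u k nu s erefl nuP sP) c_le _] :=
    bounds (u k) (alpha k) UF gU alpha_k (go_on k).
  have [_ + _] := sP; rewrite /accepted -uE dual_gradE// -/(d k).
  have : gs - b <= reference_value P a u k.
    by apply: reference_value_ge => // j /b_le; lra.
  have := ler_wpM2l (ltW gamma0) c_le => /(ler_wpM2r (ltW (d_gt0 k))).
  have -> : gamma a * s * nu * d k = gamma a * (s * nu) * d k by ring.
  lra.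
- move=> k; have [nu [s [nuP sP r01 uE]]] := step k.
  have [UF alpha_k gU] := inv k; have [UF' _ gU'] := inv k.+1.
  have [_ gap] := bounds (u k) (alpha k) UF gU alpha_k (go_on k).
  have Cd0 : 0 <= d k + C * Num.sqrt (d k).
    exact: addr_ge0 (ltW (d_gt0 k)) (mulr_ge0 C0 (sqrtr_ge0 _)).
  rewrite lerBlDr; apply: gs_le => [|V VF gV]; first by lra.
  rewrite -lerBlDr; rewrite uE in UF' gU' *.
  exact: gap.
- by exists (gs - g U0) => k; have [_ _ gU] := inv k; lra.
Qed.

End Convergence.

Theorem theorem3p9 (R : realType) (m n : nat) (P : problem R m n)
    (hmu : 0 < mu P) (hrho : 0 < rho P) (hlambda : 0 < lambda P)
    (hC : Cmat P \is symmetricmx)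
    (hA : forall i, Amat P i \is symmetricmx)
    (hK : bijective (pair_enum P))
    (hsurj : A_surjective P) (hslater : primal_slater P)
    (hF : Fset P !=set0)
    (a : params R) (ha : admissible a) (heps : eps a = 0)
    (U0 : triple R m n) (hU0 : Fset P U0)
    (alpha0 : R) (halpha0 : alpha_min a <= alpha0 <= alpha_max a) :
  (exists u alpha, execution P a U0 alpha0 u alpha) /\
  forall (u : nat -> triple R m n) (alpha : nat -> R),
    execution P a U0 alpha0 u alpha ->
    (exists k : nat,
       [/\ forall j : nat, (j < k)%N -> ~ stops P a (u j),
           stops P a (u k) &
           (dual_obj P (u k))%:E = dual_value P]) \/
    ((forall k : nat, ~ stops P a (u k)) /\
     (`|(dual_obj P (u k))%:E - dual_value P|)%E @[k --> \oo] --> 0%E).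

Proof.
have [_ [amin0 amin_max M_gt0]] := ha.
split; first exact: execution_exists.
move=> u alpha u_exec.
have inv k := execution_invariant hmu hrho hlambda hC hA ha heps hU0 halpha0
  u_exec (k := k).
have [[k k_stops]|no_stop] := pselect (exists k, stops P a (u k)).
  (* The first stopping index is taken, since feasibility of an iterate is known only if no earlier
     one stops. *)
  left; have exQ : exists k, `[< stops P a (u k) >] by exists k; apply/asboolP.
  case: (ex_minnP exQ) => j /asboolP j_stops j_min.
  have go_on i : (i < j)%N -> ~ stops P a (u i).
    by move=> ij /asboolP/j_min; rewrite leqNgt ij.
  exists j; split=> //; have [UF _ _] := inv j go_on.
  apply/le_anti/andP; split; first by apply: ereal_sup_ubound; exists (u j).
  apply: ge_ereal_sup => _ [V VF <-]; rewrite lee_fin.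
  exact: (stops_optimal hmu hrho hlambda hC hA UF heps j_stops VF).
right.
have go_on k : ~ stops P a (u k) by move=> k_stops; apply: no_stop; exists k.
split=> //.
pose S := [set dual_obj P V | V in Fset P].
have [T T0 level] := level_set_bounded (dual_obj P U0) hmu (ltW hrho)
  (ltW hlambda) hsurj hslater.
(* Finiteness of the optimal value: on the superlevel set of [U0], concavity at [U0] and the bound
   [T] on both points give an upper bound; other values are below [g U0]. *)
have S_sup : has_sup S.
  split; first by exists (dual_obj P U0), U0.
  exists (dual_obj P U0 + enorm (dual_grad P U0) * (2 * T)) => _ [V VF <-].
  have [gV|/ltW gV] := leP (dual_obj P V) (dual_obj P U0).
    rewrite (le_trans gV)// lerDl mulr_ge0 ?enorm_ge0// mulr_ge0//.
  have [_ VT] := level V (proj1 VF) (proj2 VF) gV.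
  have [_ UT] := level U0 (proj1 hU0) (proj2 hU0) (lexx _).
  rewrite (le_trans (dual_concave hmu hU0 VF))// lerD2l.
  rewrite (le_trans (dot_le_enorm _ _))// ler_wpM2l ?enorm_ge0//.
  by rewrite (le_trans (enormD _ _))// enormN; lra.
pose gs := sup S.
have dualE : dual_value P = gs%:E.
  rewrite /gs -ereal_sup_EFin; [|by case: S_sup..].
  by rewrite /dual_value /S image_comp.
have g_le k : dual_obj P (u k) <= gs.
  have [UF _ _] := inv k (fun j _ => go_on j).
  by apply: sup_upper_bound => //; exists (u k).
have gap := @execution_gap _ _ _ P a hmu hrho hlambda hC hA hsurj hslater ha
  heps U0 alpha0 hU0 halpha0 u alpha u_exec gs go_on.
have {}gap e : 0 < e ->
    exists N, forall k, (N <= k)%N -> gs - dual_obj P (u k) <= e.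
  apply: gap => b U0b b_ub; apply: sup_le_ub; first by case: S_sup.
  move=> _ [V VF <-]; have [gV|/ltW gV] := leP (dual_obj P U0) (dual_obj P V).
    exact: b_ub.
  exact: le_trans gV U0b.
rewrite dualE (_ : (fun k => _) = (fun k => (gs - dual_obj P (u k))%:E)).
  apply: cvg_EFin; first by apply: nearW.
  apply/cvgrPdist_le => e /gap[N HN]; exists N => // k /HN gap_k.
  by rewrite /= sub0r normrN ger0_norm// subr_ge0.
by apply/funext => k; rewrite -EFinB abse_EFin distrC ger0_norm// subr_ge0.
Qed.
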